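(* In the infinite time context, suppose that $A,B\subseteq 2^\omega$ are reducible to each other by computable one-to-one total functions $f$ and $g$ (that is, $x\in A\iff f(x)\in B$ and $x\in B\iff g(x)\in A$), whose inverses are computable and whose ranges are decidable. Then there is a computable permutation $\pi:2^\omega\to 2^\omega$ with $\pi^{-1}$ also computable and $\pi[A]=B$.
   Context: Infinite time Turing machines: three-tape machines with finite programs; successor steps as classically; at limit stages the head returns to the leftmost cell, a special limit state is entered and each cell takes the $\limsup$ of its previous values. Reals are elements of $2^\omega$. A partial function on reals is (infinite time) computable if some program computes it; a set of reals is decidable if its characteristic function is computable. *)

(* Defs.v *)
From mathcomp Require Import all_boot.
From mathcomp Require Import boolp classical_sets wochoice.

Set Implicit Arguments.
Unset Strict Implicit.
Unset Printing Implicit Defensive.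

Local Open Scope classical_set_scope.

Definition real := nat -> bool.

Inductive direction := MoveLeft | MoveRight.

(* The bit triples are the contents of the input, scratch and output tapes at
   the position of the (single) head. *)
Record program := Program {
  states : finType;
  start_state : states;
  halt_state : states;
  limit_state : states;
  special_uniq : uniq [:: start_state; halt_state; limit_state];
  transition : states -> bool * bool * bool ->
               states * (bool * bool * bool) * direction
}.

Record config (p : program) := Config {
  state : states p;
  head_pos : nat;
  input_tape : real;
  scratch_tape : real;
  output_tape : real
}.

Definition write (t : real) (i : nat) (b : bool) : real :=
  fun j => if j == i then b else t j.

(* A head told to move left on the leftmost cell stays there: 0.-1 = 0. *)
Definition move (d : direction) (i : nat) : nat :=
  match d with MoveLeft => i.-1 | MoveRight => i.+1 end.

Definition init_config (p : program) (x : real) : config p :=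
  {| state := start_state p; head_pos := 0;
     input_tape := x;
     scratch_tape := fun=> false; output_tape := fun=> false |}.

Definition step (p : program) (c : config p) : config p :=
  let i := head_pos c in
  let: (q, (a, b, o), d) := transition (state c)
         (input_tape c i, scratch_tape c i, output_tape c i) in
  {| state := q; head_pos := move d i;
     input_tape := write (input_tape c) i a;
     scratch_tape := write (scratch_tape c) i b;
     output_tape := write (output_tape c) i o |}.

(* Ordinal stages are represented by the elements of a well-ordered type. *)
Section Stages.
Variables (W : eqType) (le : rel W).
Implicit Types u v w : W.

Definition before v w : bool := ~~ le w v.

Definition zero_stage w : Prop := forall v, ~ before v w.

Definition succ_stage v w : Prop :=
  before v w /\ forall u, ~ (before v u /\ before u w).

Definition limit_stage w : Prop :=
  ~ zero_stage w /\ forall v, ~ succ_stage v w.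

(* b is the limsup of the bits h u over the stages u before w, i.e. the
   infimum over v < w of the suprema over v <= u < w. *)
Definition is_limsup (h : W -> bool) w (b : bool) : Prop :=
  b <-> forall v, before v w -> exists u, [/\ le v u, before u w & h u].

Definition limit_config (p : program) (r : W -> config p) w : Prop :=
  [/\ state (r w) = limit_state p,
      head_pos (r w) = 0,
      forall i, is_limsup (fun u => input_tape (r u) i) w (input_tape (r w) i),
      forall i, is_limsup (fun u => scratch_tape (r u) i) w
                          (scratch_tape (r w) i)
    & forall i, is_limsup (fun u => output_tape (r u) i) w
                          (output_tape (r w) i)].

Definition is_run (p : program) (x : real) (r : W -> config p) : Prop :=
  [/\ forall w, zero_stage w -> r w = init_config p x,
      forall v w, succ_stage v w -> r w = step (r v)
    & forall w, limit_stage w -> limit_config r w].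

End Stages.

(* y is the content of the output tape at the first stage at which the halt
   state is reached; what r does at later stages is irrelevant. *)
Definition computes (p : program) (x y : real) : Prop :=
  exists (W : eqType) (le : rel W) (r : W -> config p) (w : W),
    [/\ well_order le,
        is_run le x r,
        state (r w) = halt_state p,
        forall v, before le v w -> state (r v) <> halt_state p
      & output_tape (r w) = y].

(* A partial function on the reals is given by its graph; p diverges exactly
   outside the domain. *)
Definition it_computable_graph (G : real -> real -> Prop) : Prop :=
  exists p : program, forall x y, computes p x y <-> G x y.

Definition it_computable (f : real -> real) : Prop :=
  it_computable_graph (fun x y => y = f x).

(* For injective f, the graph of the partial function with domain range f. *)
Definition it_computable_inverse (f : real -> real) : Prop :=
  it_computable_graph (fun y x => y = f x).

(* The numbers 0 and 1 as reals: n is coded by n ones followed by zeros. *)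
Definition real_of_nat (n : nat) : real := fun i => i < n.

Definition it_decidable (A : set real) : Prop :=
  it_computable (fun x => real_of_nat (x \in A)).

(* Main.v *)
Require Import Defs.
From mathcomp Require Import all_boot zify.
From mathcomp Require Import boolp classical_sets wochoice.

(* Follow an input x backwards through g^-1, f^-1, g^-1, ... as long as the
   membership tests for the two ranges allow it.  If this chain stops outside
   range f, put pi x = g^-1 x; if it stops outside range g or never stops, put
   pi x = f x.  This is a permutation, and its inverse is decided by the same
   backward search.  A machine performs the search by calling the six given
   programs; a chain that never stops is recognised at the limit of its stages.

   Since a program has only three tapes and its callees need all of them, the
   search is first programmed on a machine whose cells carry several tracks;
   that machine is then simulated on the scratch tape, one block of cells per
   cell, after spreading out the input by a zigzag in omega steps.  Runs along
   different well-orders are pasted together along lexicographic sums. *)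

Set Implicit Arguments.
Unset Strict Implicit.
Unset Printing Implicit Defensive.

(** A program for an inverse diverges off the range, so each backward step needs a membership test
    first; this is where decidability of the ranges enters. The obstacle is the limit stage: it
    erases the control state and the head position and leaves only limsups of cells. Whatever must
    survive is therefore stored in cells whose bits are frozen or are 1 cofinally often. A limit may
    lie inside a called program, end a copying pass, or follow infinitely many calls; flags at the
    leftmost cell tell these cases apart. After infinitely many calls the current real is scrambled,
    so the original input stays on a track of its own, and the final map is applied to that track.
    Sending the non-terminating chains to the [f] side is an arbitrary choice: [f] and the inverse
    of [g] both respect [A] and [B], and bijectivity only needs the choice to be constant along a
    chain. *)

Section WellOrder.
Variables (W : eqType) (le : rel W).
Hypothesis wo : well_order le.
Implicit Types (u v w : W) (P : W -> Prop).

Lemma wo_min P : (exists w, P w) -> exists2 w, P w & forall v, P v -> le w v.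
Proof.
move=> [w Pw]; have [|z [[zP zmin] _]] := wo (A := [pred v | `[< P v >]]).
  by exists w; apply/asboolP.
by exists z => [|v Pv]; [exact/asboolP|apply: zmin; apply/asboolP].
Qed.

Lemma wo_total : total le.
Proof.
move=> u v; have [|w [->|->] wmin] := @wo_min (fun w => w = u \/ w = v).
- by exists u; left.
- by rewrite wmin //; right.
- by rewrite (wmin u) ?orbT //; left.
Qed.

Lemma wo_refl : reflexive le.
Proof. by move=> w; have := wo_total w w; rewrite orbb. Qed.

Lemma wo_anti u v : le u v -> le v u -> u = v.
Proof.
move=> uv vu; have [|z [_ zuniq]] := wo (A := [pred w | (w == u) || (w == v)]).
  by exists u; rewrite inE eqxx.
have lb w : w = u \/ w = v -> lower_bound le [pred w | (w == u) || (w == v)] w.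
  by move=> [] -> t; rewrite inE => /orP[] /eqP -> //; exact: wo_refl.
have <- : z = u by apply: zuniq; split; [rewrite inE eqxx|apply: lb; left].
by apply: zuniq; split; [rewrite inE eqxx orbT|apply: lb; right].
Qed.

Lemma wo_trans : transitive le.
Proof.
move=> v u w uv vw.
have [|z zP zmin] := @wo_min (fun w' => [\/ w' = u, w' = v | w' = w]).
  by exists u; constructor 1.
case: zP => zE; rewrite zE in zmin.
- by apply: zmin; constructor 3.
- suff <- : v = u by [].
  by apply: wo_anti => //; apply: zmin; constructor 1.
suff <- : v = w by [].
by apply: wo_anti => //; apply: zmin; constructor 2.
Qed.

Lemma beforeW u v : before le u v -> le u v.
Proof. by rewrite /before; case/orP: (wo_total u v) => ->. Qed.

Lemma beforeN u v : ~~ before le u v = le v u.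
Proof. by rewrite /before negbK. Qed.

Lemma before_irr u : before le u u = false.
Proof. by rewrite /before wo_refl. Qed.

Lemma before_le_trans v u w : before le u v -> le v w -> before le u w.
Proof. by rewrite /before => uv vw; apply: contra uv; apply: wo_trans. Qed.

Lemma le_before_trans v u w : le u v -> before le v w -> before le u w.
Proof. by rewrite /before => uv; apply: contra => wu; apply: wo_trans uv. Qed.

Lemma before_trans v u w : before le u v -> before le v w -> before le u w.
Proof. by move=> /beforeW; apply: le_before_trans. Qed.

Lemma le_eqVbefore u v : le u v -> u = v \/ before le u v.
Proof.
by move=> uv; have [/(wo_anti uv)|] := boolP (le v u); [left|right].
Qed.

Lemma trichotomy u v : [\/ u = v, before le u v | before le v u].
Proof.
have [vu|] := boolP (le v u); last by constructor 2.
by have [->|] := le_eqVbefore vu; [constructor 1|constructor 3].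
Qed.

Lemma wo_ind P : (forall w, (forall v, before le v w -> P v) -> P w) ->
  forall w, P w.
Proof.
move=> IH w; apply: contrapT => nPw.
have [|z nPz zmin] := @wo_min (fun v => ~ P v); first by exists w.
apply: nPz; apply: IH => v vz; apply: contrapT => /zmin zv.
by rewrite /before zv in vz.
Qed.

Lemma zero_stageP w : zero_stage le w <-> forall v, le w v.
Proof.
split=> [w0 v|w0 v]; last by rewrite /before w0.
by rewrite -beforeN; apply/negP.
Qed.

Lemma ex_zero_stage w : exists z, zero_stage le z.
Proof.
have [|z _ zmin] := @wo_min (fun _ => True); first by exists w.
by exists z; apply/zero_stageP => v; apply: zmin.
Qed.

Lemma ex_succ_stage u w : before le u w ->
  exists2 v, succ_stage le u v & le v w.
Proof.
move=> uw; have [|v uv vmin] := @wo_min (fun v => before le u v).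
  by exists w.
exists v; last exact: vmin.
by split=> // t [/vmin vt]; rewrite /before vt.
Qed.

Lemma succ_stage_le u v w : succ_stage le u w -> before le v w -> le v u.
Proof. by move=> [uw nu] vw; rewrite -beforeN; apply/negP => uv; case: (nu v). Qed.

Lemma stage_cases w :
  [\/ zero_stage le w, exists v, succ_stage le v w | limit_stage le w].
Proof.
have [?|nz] := pselect (zero_stage le w); first by constructor 1.
have [?|ns] := pselect (exists v, succ_stage le v w); first by constructor 2.
by constructor 3; split=> // v vw; apply: ns; exists v.
Qed.

Lemma limit_between w v : limit_stage le w -> before le v w ->
  exists2 u, before le v u & before le u w.
Proof.
move=> [_ ns] vw; apply: contrapT => nb; apply: (ns v); split=> // u [vu uw].
by apply: nb; exists u.
Qed.

End WellOrder.

Lemma mk_well_order (W : eqType) (le : rel W) :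
  (forall u v, le u v -> le v u -> u = v) ->
  (forall P : W -> Prop, (exists w, P w) ->
     exists2 w, P w & forall v, P v -> le w v) ->
  well_order le.
Proof.
move=> anti mn; apply: antisymmetric_well_order.
  by move=> u v /andP[]; apply: anti.
move=> A [w Aw]; have [|z zA zmin] := mn (fun v => v \in A); first by exists w.
by exists z; split.
Qed.

(** * Lexicographic sums of well-orders *)

Section LexSum.
Variables (I : eqType) (leI : rel I) (W : I -> eqType) (le : forall i, rel (W i)).
Hypothesis woI : well_order leI.
Hypothesis wo : forall i, well_order (@le i).
Local Notation T := {i : I & W i}.

Definition lex_le : rel T := fun u v =>
  before leI (tag u) (tag v) ||
  (tag u == tag v) && le (tagged u) (tagged_as u v).

Lemma lex_le_same i (a b : W i) :
  lex_le (Tagged W a) (Tagged W b) = le a b.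
Proof. by rewrite /lex_le /= before_irr // eqxx tagged_asE. Qed.

Lemma lex_le_tag u v : lex_le u v -> leI (tag u) (tag v).
Proof. by case/orP => [/(beforeW woI)//|/andP[/eqP<- _]]; exact: wo_refl. Qed.

Lemma lex_le_before u v : before leI (tag u) (tag v) -> lex_le u v.
Proof. by rewrite /lex_le => ->. Qed.

Lemma lex_before_same i (a b : W i) :
  before lex_le (Tagged W a) (Tagged W b) = before (@le i) a b.
Proof. by rewrite /before lex_le_same. Qed.

Lemma lex_before_tag u v : before leI (tag u) (tag v) -> before lex_le u v.
Proof. by rewrite /before; apply: contra => /lex_le_tag. Qed.

Lemma lex_beforeE u v : before lex_le u v ->
  before leI (tag u) (tag v) \/ tag u = tag v.
Proof.
move=> uv; have [e|//|vu] := trichotomy woI (tag u) (tag v); auto.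
by rewrite /before lex_le_before in uv.
Qed.

Lemma lex_well_order : well_order lex_le.
Proof.
apply: mk_well_order.
  move=> [i a] [j b] uv vu.
  have ij : i = j by exact: (wo_anti woI (lex_le_tag uv) (lex_le_tag vu)).
  rewrite -ij in b uv vu *; move: uv vu; rewrite !lex_le_same => ab ba.
  by rewrite (wo_anti (@wo i) ab ba).
move=> P [[i a] Pia].
have [|j [b Pjb] jmin] := @wo_min _ _ woI (fun j => exists b : W j, P (Tagged W b)).
  by exists i, a.
have [|c Pc cmin] := @wo_min _ _ (@wo j) (fun b => P (Tagged W b)).
  by exists b.
exists (Tagged W c) => // -[k d] Pkd.
have [jk|jk] := le_eqVbefore woI (jmin k (ex_intro _ d Pkd)); last first.
  exact: lex_le_before.
by rewrite -jk in d Pkd *; rewrite lex_le_same; exact: cmin.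
Qed.

End LexSum.

(** * Transfinite passages of a transition system *)

(** A limsup of bits is 1 exactly when the bit is 1 cofinally often. *)
Definition cofinal_in (W : eqType) (le : rel W) (D P : W -> Prop) : Prop :=
  forall v, D v -> exists u, [/\ D u, le v u & P u].

Section Paths.
Variables (C O : Type) (bit : O -> C -> bool) (st : C -> C) (isl : C -> Prop).

(** [P] need not be the bits of a run: in a sum of runs, [P o k] says that bit [o] is 1 somewhere in
    block [k]. *)
Definition limit_of (W : eqType) (le : rel W) (D : W -> Prop)
    (P : O -> W -> Prop) (c : C) : Prop :=
  isl c /\ forall o, bit o c <-> cofinal_in le D (P o).

(* When D is an initial segment of the stages, c is the configuration of the
   first stage after D. *)
Definition after (W : eqType) (le : rel W) (D : W -> Prop) (r : W -> C)
    (c : C) : Prop :=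
  (forall t, D t -> (forall v, D v -> le v t) -> c = st (r t)) /\
  ((forall v, D v -> exists2 u, D u & before le v u) ->
   limit_of le D (fun o u => bit o (r u)) c).

Definition run_from (W : eqType) (le : rel W) (r : W -> C) (c : C) : Prop :=
  forall w, (zero_stage le w -> r w = c) /\
    (~ zero_stage le w -> after le (fun v => before le v w) r (r w)).

(* Half-open intervals of stages: V is the set of configurations visited, and b,
   the configuration of the next stage, is not counted.  In this form passages
   can be concatenated, transfinitely often, without overlap. *)
Definition passage (V : C -> Prop) (a b : C) : Prop :=
  exists (W : eqType) (le : rel W) (r : W -> C),
    [/\ well_order le, inhabited W, run_from le r a,
        after le (fun _ => True) r b & forall c, V c <-> exists w, r w = c].

Lemma passage_start V a b : passage V a b -> V a.
Proof.
move=> [W [le [r [wo [w] run _ VE]]]]; apply/VE.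
have [z z0] := ex_zero_stage wo w; exists z.
by have [-> ] := run z.
Qed.

Section Sum.
Variables (I : eqType) (leI : rel I) (W : I -> eqType) (le : forall i, rel (W i)).
Hypothesis woI : well_order leI.
Hypothesis wo : forall i, well_order (@le i).
Hypothesis W0 : forall i, inhabited (W i).
Variables (r : forall i, W i -> C).
Local Notation T := {i : I & W i}.
Local Notation leT := (lex_le leI le).
Let R (u : T) : C := r (tagged u).

(** The part [E] of [D] in its last block [i] is nonempty, hence cofinal in [D]; earlier blocks
    influence neither a last stage nor a limsup. *)
Lemma after_block (D : T -> Prop) i (E : W i -> Prop) c :
    (forall u, before leI (tag u) i -> D u) ->
    (forall u, D u -> leI (tag u) i) ->
    (forall a : W i, D (Tagged W a) <-> E a) ->
    (exists a, E a) ->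
  after (@le i) E (@r i) c -> after leT D R c.
Proof.
move=> Dlt Dle DE [a0 Ea0] [Etop Elim]; split.
  move=> [j t] Djt top; have ij : i = j.
    apply: (wo_anti woI) (Dle _ Djt).
    by have /top/(lex_le_tag woI) := (DE a0).2 Ea0.
  rewrite -{j}ij in t Djt top *; apply: Etop; first exact/DE.
  by move=> v Ev; rewrite -(lex_le_same _ woI); apply: top; apply/DE.
move=> notop; have [|lc bc] := Elim.
  move=> v Ev; have [[j u] Dju vu] := notop _ ((DE v).2 Ev).
  have ij : i = j.
    apply: (wo_anti woI) (Dle _ Dju).
    by have /(beforeW (lex_well_order woI wo))/(lex_le_tag woI) := vu.
  rewrite -{j}ij in u Dju vu *; exists u; first exact/DE.
  by rewrite lex_before_same in vu.
split=> // o; rewrite bc; split=> cof.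
  move=> [j v] Djv; have [ji|ij] := le_eqVbefore woI (Dle _ Djv).
    rewrite /= in ji; rewrite {j}ji in v Djv *.
    have [u [Eu vu ou]] := cof v ((DE v).1 Djv).
    by exists (Tagged W u); split; rewrite ?lex_le_same //; apply/DE.
  have [u [Eu _ ou]] := cof a0 Ea0; exists (Tagged W u); split=> //; first exact/DE.
  exact: lex_le_before.
move=> v Ev; have [[j u] [Dju vu ou]] := cof _ ((DE v).2 Ev).
have ij : i = j.
  by apply: (wo_anti woI) (Dle _ Dju); have /(lex_le_tag woI) := vu.
rewrite -{j}ij in u Dju vu ou *; exists u; split=> //; first exact/DE.
by rewrite lex_le_same in vu.
Qed.

Lemma after_blocks (D : T -> Prop) (J : I -> Prop) c :
    (forall u, D u <-> J (tag u)) -> (exists j, J j) ->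
    (forall j, J j -> exists2 k, J k & before leI j k) ->
    limit_of leI J (fun o k => exists v, bit o (@r k v)) c ->
  after leT D R c.
Proof.
move=> DJ [j0 Jj0] Jnotop [lc bc]; split.
  move=> [j t] /DJ/= Jj top; have [k Jk jk] := Jnotop _ Jj.
  have [a] := W0 k; have /top/(lex_le_tag woI)/= kj : D (Tagged W a) by apply/DJ.
  by rewrite /before kj in jk.
move=> _; split=> // o; rewrite bc; split=> cof.
  (* A stage of block [j] itself might precede [v], so the search starts in a strictly later
     block. *)
  move=> [j v] /DJ/= Jj; have [j' Jj' jj'] := Jnotop _ Jj.
  have [k [Jk jk [a oa]]] := cof j' Jj'.
  exists (Tagged W a); split=> //; first exact/DJ.
  by apply: lex_le_before; apply: before_le_trans jk.
move=> j Jj; have [a] := W0 j.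
have [|[k v] [/DJ/= Jk /(lex_le_tag woI)/= jk ov]] := cof (Tagged W a).
  exact/DJ.
by exists k; split=> //; exists v.
Qed.

Variables (s e : I -> C) (a b : C).
Hypothesis rs : forall i, run_from (@le i) (@r i) (s i).
Hypothesis re : forall i, after (@le i) (fun _ => True) (@r i) (e i).
Hypothesis s0 : forall i, zero_stage leI i -> s i = a.
Hypothesis sS : forall i j, succ_stage leI i j -> s j = e i.
Hypothesis sL : forall j, limit_stage leI j ->
  limit_of leI (fun i => before leI i j) (fun o k => exists v, bit o (@r k v)) (s j).

Lemma run_from_sum : run_from leT R a.
Proof.
have woT := lex_well_order woI wo.
move=> [i w]; split=> [/zero_stageP z|nz].
  have zi : zero_stage leI i.
    apply/zero_stageP => j; have [v] := W0 j.
    exact: (lex_le_tag woI (z (Tagged W v))).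
  have zw : zero_stage (@le i) w.
    by apply/zero_stageP => v; have := z (Tagged W v); rewrite lex_le_same.
  by rewrite /R /=; have [-> //] := @rs i w; rewrite s0.
have [zw|nzw] := pselect (zero_stage (@le i) w); last first.
  have [_ /(_ nzw) aft] := @rs i w; apply: after_block aft => //.
  - by move=> u ui; apply: lex_before_tag.
  - by move=> u /(beforeW woT)/(lex_le_tag woI).
  - by move=> v; rewrite lex_before_same.
  - apply: contrapT => ne; apply: nzw => v vw; apply: ne; by exists v.
rewrite /R /=; have [-> // _] := @rs i w.
have bi u : before leT u (Tagged W w) <-> before leI (tag u) i.
  split=> [uw|ui]; last exact: lex_before_tag.
  have [//|/= ui] := lex_beforeE woI uw.
  case: u ui uw => j u /= ji; rewrite {j}ji in u *; rewrite lex_before_same // => uw.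
  by have := zw _ uw.
(* Here [w] opens block [i], so the stages before it form whole blocks, with a last one [j] or with
   none. *)
case: (stage_cases leI i) => [zi|[j ji]|li].
- case: nz => -[j v] /bi/= ji; exact: zi ji.
- rewrite (sS ji); apply: (after_block (i := j) (E := fun _ => True)) => //.
  + by move=> u uj; apply/bi; case: ji => ji _; apply: before_trans ji.
  + by move=> u /bi; apply: succ_stage_le ji.
  + by move=> v; split=> // _; apply/bi; case: ji.
  + by have [v] := W0 j; exists v.
- apply: (after_blocks (J := fun j => before leI j i)); last exact: sL.
  + exact: bi.
  + apply: contrapT => ne; case: li => nzi _; apply: nzi => j ji; by apply: ne; exists j.
  + move=> j ji; have [k jk ki] := limit_between li ji; by exists k.
Qed.

Hypothesis bT : forall i, (forall j, leI j i) -> b = e i.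
Hypothesis bL : (forall i, exists j, before leI i j) ->
  limit_of leI (fun _ => True) (fun o k => exists v, bit o (@r k v)) b.

Lemma after_sum : inhabited I -> after leT (fun _ => True) R b.
Proof.
move=> [i0].
have [[i top]|ntop] := pselect (exists i, forall j, leI j i).
  rewrite (bT top); apply: after_block (re i) => //.
  by have [v] := W0 i; exists v.
apply: (after_blocks (J := fun _ => True)) => //.
  move=> j _; apply: contrapT => nk; apply: ntop; exists j => k.
  by rewrite -beforeN; apply/negP => jk; apply: nk; exists k.
apply: bL => i; apply: contrapT => nk; apply: ntop; exists i => k.
by rewrite -beforeN; apply/negP => jk; apply: nk; exists k.
Qed.

End Sum.

(** Stating limits through the visited sets [V k] hides the stages inside the summands. *)
Lemma passage_sum (I : eqType) (leI : rel I) (V : I -> C -> Prop) (s e : I -> C) a b :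
    well_order leI -> inhabited I ->
    (forall i, passage (V i) (s i) (e i)) ->
    (forall i, zero_stage leI i -> s i = a) ->
    (forall i j, succ_stage leI i j -> s j = e i) ->
    (forall j, limit_stage leI j ->
       limit_of leI (fun i => before leI i j)
         (fun o k => exists2 d, V k d & bit o d) (s j)) ->
    (forall i, (forall j, leI j i) -> b = e i) ->
    ((forall i, exists j, before leI i j) ->
      limit_of leI (fun _ => True) (fun o k => exists2 d, V k d & bit o d) b) ->
  passage (fun c => exists i, V i c) a b.
Proof.
move=> woI I0 p s0 sS sL bT bL.
pose Wi i := sval (cid (p i)).
have p1 i := svalP (cid (p i)).
pose lei i : rel (Wi i) := sval (cid (p1 i)).
have p2 i := svalP (cid (p1 i)).
pose ri i : Wi i -> C := sval (cid (p2 i)).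
have p3 i := svalP (cid (p2 i)).
have wo i : well_order (lei i) by case: (p3 i).
have W0 i : inhabited (Wi i) by case: (p3 i).
have VE i c : V i c <-> exists w, ri i w = c by case: (p3 i).
have lim_eq D c : limit_of leI D (fun o k => exists2 d, V k d & bit o d) c ->
    limit_of leI D (fun o k => exists v, bit o (ri k v)) c.
  move=> [lc bc]; split=> // o; rewrite bc; split=> cof v /cof[u [Du vu [d]]].
    by move/VE => [w <-] ow; exists u; split=> //; exists w.
  move=> od; exists u; split=> //; exists (ri u d) => //; apply/VE; by exists d.
exists {i : I & Wi i}, (lex_le leI lei), (fun u => ri (tag u) (tagged u)); split.
- exact: lex_well_order.
- by case: I0 => i; case: (W0 i) => w; constructor; exact: (Tagged Wi w).
- apply: (@run_from_sum _ _ _ _ woI wo W0 ri s e) => //.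
  + by move=> i; case: (p3 i).
  + by move=> i; case: (p3 i).
  + by move=> j /sL/lim_eq.
- apply: (@after_sum _ _ _ _ woI wo W0 ri e) => //.
  + by move=> i; case: (p3 i).
  + by move/bL/lim_eq.
- move=> c; split=> [[i /VE[w <-]]|[[i w] <-]]; first by exists (Tagged Wi w).
  by exists i; apply/VE; exists w.
Qed.

Lemma passage_step c : passage (fun d => d = c) c (st c).
Proof.
have wo : well_order (fun _ _ : unit => true).
  apply: mk_well_order => [[] []//|P [[] P0]]; by exists tt.
exists unit, (fun _ _ => true), (fun _ => c); split=> //.
- move=> []; split=> // -[]; apply/zero_stageP => //.
- by split=> // notop; have [] := notop tt I.
- by move=> d; split=> [->|[] //]; exists tt.
Qed.

Lemma passage_trans V1 V2 a b c :
  passage V1 a b -> passage V2 b c -> passage (fun d => V1 d \/ V2 d) a c.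
Proof.
(* Implication puts [false] before [true], which gives a sum of two blocks. *)
move=> p1 p2; pose leb (x y : bool) := x ==> y.
have wo : well_order leb.
  apply: mk_well_order => [[] []//|P [x Px]].
  have [Pf|nPf] := pselect (P false); first by exists false.
  exists true => [|[]//]; by case: x Px.
have -> : (fun d => V1 d \/ V2 d) = (fun d => exists i : bool, (if i then V2 else V1) d).
  apply/funext => d; apply/propext; split=> [[]|[[]]]; auto.
    by exists false.
  by exists true.
apply: (@passage_sum _ leb _ (fun i => if i then b else a) (fun i => if i then c else b)) => //.
- by constructor; exact: true.
- by case.
- by move=> [] // z; case: (z false).
- by move=> [] [] [] //.
- move=> [] [nz ns]; last by case: nz => -[].
  case: (ns false); split=> // -[] [] //.
- by move=> [] // /(_ true).
- by move=> /(_ true) [[]].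
Qed.

Lemma passage_omega (V : nat -> C -> Prop) (F : nat -> C) c :
    (forall n, passage (V n) (F n) (F n.+1)) -> isl c ->
    (forall o, bit o c <-> forall n, exists k, [/\ n <= k & exists2 d, V k d & bit o d]) ->
  passage (fun d => exists n, V n d) (F 0) c.
Proof.
move=> p lc bc.
have wo : well_order leq.
  apply: mk_well_order => [u v uv vu|P [w Pw]]; first by apply/eqP; rewrite eqn_leq uv vu.
  have ex : exists n, `[< P n >] by exists w; apply/asboolP.
  by case: (ex_minnP ex) => m /asboolP Pm mmin; exists m => // v /asboolP /mmin.
have bef u v : before leq u v = (u < v) by rewrite /before -ltnNge.
apply: (@passage_sum _ leq _ _ (fun n => F n.+1)) => //.
- by constructor; exact: 0.
- by move=> i /zero_stageP/(_ 0); rewrite leqn0 => /eqP->.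
- move=> i j [ij nb]; congr F; apply/eqP; rewrite eqn_leq -bef ij andbT leqNgt.
  by apply/negP => ij1; apply: (nb i.+1); rewrite !bef.
- move=> [|j] [nz ns]; first by case: nz => v; rewrite bef.
  case: (ns j); split=> [|u [+ +]]; rewrite !bef // ltnS => ju uj.
  by rewrite ltnNge uj in ju.
- by move=> i /(_ i.+1); rewrite ltnn.
- move=> _; split=> // o; rewrite bc; split=> cof n; last first.
    by have [k [_ nk kd]] := cof n I; exists k.
  by move=> _; have [k [nk kd]] := cof n; exists k.
Qed.

(** The end point [b] need not satisfy [P], so a run into a halting configuration can be bounded by
    a predicate that excludes halting. *)
Definition reach (P : C -> Prop) (a b : C) : Prop :=
  exists2 V, passage V a b & forall d, V d -> P d.

Lemma reach_step (P : C -> Prop) c : P c -> reach P c (st c).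
Proof. by move=> Pc; exists (fun d => d = c); [exact: passage_step|move=> d ->]. Qed.

Lemma reach_trans P a b c : reach P a b -> reach P b c -> reach P a c.
Proof.
move=> [V1 p1 P1] [V2 p2 P2]; exists (fun d => V1 d \/ V2 d); first exact: passage_trans p2.
by move=> d [/P1|/P2].
Qed.

Lemma reach_weaken (P Q : C -> Prop) a b :
  (forall c, P c -> Q c) -> reach P a b -> reach Q a b.
Proof. by move=> PQ [V p VP]; exists V => // d /VP/PQ. Qed.

Lemma reach_iter (P : C -> Prop) (F : nat -> C) n :
    (forall m, m < n -> P (F m) /\ F m.+1 = st (F m)) -> 0 < n ->
  reach P (F 0) (F n).
Proof.
case: n => // n; elim: n => [|n IH] H _.
  by have [P0 ->] := H 0 isT; exact: reach_step.
apply: (@reach_trans _ _ (F n.+1)); first by apply: IH => // m /ltnW/H.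
by have [Pn ->] := H n.+1 (ltnSn _); exact: reach_step.
Qed.

(** Every bit is eventually constant, so its limsup is its eventual value; [Q n] controls what the
    [n]-th segment visits. *)
Lemma reach_omega (P : C -> Prop) (Q : nat -> C -> Prop) (F : nat -> C) c :
    (forall n, reach (Q n) (F n) (F n.+1)) ->
    (forall n d, Q n d -> P d) -> isl c ->
    (forall o, exists n, forall k d, n <= k -> Q k d -> bit o d = bit o c) ->
  reach P (F 0) c.
Proof.
move=> r QP lc ev.
have [V pV] := choice (fun n => let: ex_intro2 V p VQ := r n in ex_intro _ V (conj p VQ)).
exists (fun d => exists n, V n d); last by move=> d [n] /(pV n).2/QP.
apply: passage_omega => // [n|o]; first by case: (pV n).
have [n evn] := ev o; split=> [oc m|].
  exists (maxn n m); split; first exact: leq_maxr.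
  exists (F (maxn n m)); first by have [/passage_start] := pV (maxn n m).
  rewrite (evn (maxn n m)) ?leq_maxl //; have [p] := pV (maxn n m).
  by apply; exact: passage_start p.
move=> /(_ n) [k [nk [d /(pV k).2 Qd od]]]; by rewrite -(evn k d).
Qed.

End Paths.

Section AfterStages.
Variables (C O : Type) (bit : O -> C -> bool) (st : C -> C) (isl : C -> Prop).
Local Notation after := (after bit st isl).

Lemma after_succ (W : eqType) (le : rel W) (r : W -> C) c v w :
    well_order le -> succ_stage le v w ->
  after le (fun u => before le u w) r c <-> c = st (r v).
Proof.
move=> wo [vw nb]; split=> [[top _]|->].
  by apply: top => // u; apply: (succ_stage_le (conj vw nb)).
split=> [t tw top|notop].
  suff -> : v = t by [].
  by apply: (wo_anti wo); [exact: top|exact: succ_stage_le (conj vw nb) tw].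
by have [u uw vu] := notop v vw; case: (nb u).
Qed.

Lemma after_limit (W : eqType) (le : rel W) (r : W -> C) c w :
    well_order le -> limit_stage le w ->
  after le (fun u => before le u w) r c <->
  limit_of bit isl le (fun u => before le u w) (fun o u => bit o (r u)) c.
Proof.
move=> wo lw.
have notop v : before le v w -> exists2 u, before le u w & before le v u.
  by move=> /(limit_between lw)[u vu uw]; exists u.
split=> [[_]|lc]; first exact.
split=> // t /notop[u uw tu] top.
by have := top u uw; rewrite -(beforeN le) tu.
Qed.

(** Only the order on [D] matters. This allows cutting a run at its halting stage and, conversely,
    adding a last stage. *)
Lemma after_embed (W1 W2 : eqType) (le1 : rel W1) (le2 : rel W2) (f : W1 -> W2)
    (D1 : W1 -> Prop) (D2 : W2 -> Prop) (r : W2 -> C) c :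
    (forall u v, le2 (f u) (f v) = le1 u v) ->
    (forall v, D2 v <-> exists2 u, D1 u & f u = v) ->
  after le1 D1 (fun u => r (f u)) c <-> after le2 D2 r c.
Proof.
move=> fle DE.
have Df u : D1 u -> D2 (f u) by move=> Du; apply/DE; exists u.
have fbefore u v : before le2 (f u) (f v) = before le1 u v by rewrite /before fle.
split=> -[top lim]; split.
- move=> _ /DE[t Dt <-] tmax; apply: top => // v Dv; rewrite -fle; exact/tmax/Df.
- move=> notop; have [|lc bc] := lim.
    move=> v /Df/notop[_ /DE[u Du <-]]; rewrite fbefore => vu; by exists u.
  split=> // o; rewrite bc; split=> cof.
    move=> _ /DE[v Dv <-]; have [u [Du vu ou]] := cof v Dv.
    by exists (f u); split; rewrite ?fle //; exact: Df.
  move=> v /Df/cof[_ [/DE[u Du <-]]]; rewrite fle => vu ou; by exists u.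
- move=> t Dt tmax; apply: top; first exact: Df.
  by move=> _ /DE[v Dv <-]; rewrite fle; exact: tmax.
- move=> notop; have [|lc bc] := lim.
    move=> _ /DE[v Dv <-]; have [u Du vu] := notop v Dv.
    by exists (f u); rewrite ?fbefore //; exact: Df.
  split=> // o; rewrite bc; split=> cof.
    move=> v /Df/cof[_ [/DE[u Du <-]]]; rewrite fle => vu ou; by exists u.
  move=> _ /DE[v Dv <-]; have [u [Du vu ou]] := cof v Dv.
  by exists (f u); split; rewrite ?fle //; exact: Df.
Qed.

End AfterStages.

(** * Comparison of different well-orders and determinism of runs *)

Section SameRank.
Variables (W1 W2 : eqType) (le1 : rel W1) (le2 : rel W2).

(* Equality of the order types of the initial segments below w1 and w2, as a
   bisimulation. *)
Inductive same_rank (w1 : W1) (w2 : W2) : Prop :=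
  SameRank of
    (forall v1, before le1 v1 w1 -> exists2 v2, before le2 v2 w2 & same_rank v1 v2)
  & (forall v2, before le2 v2 w2 -> exists2 v1, before le1 v1 w1 & same_rank v1 v2).

Hypotheses (wo1 : well_order le1) (wo2 : well_order le2).

(** Comparability of ordinals: if some [v1] below [w1] has no partner below [w2], induction at [v1]
    matches [w2] with [v1] or with a stage below [v1]; the other side is symmetric. *)
Lemma same_rank_total w1 w2 :
  [\/ same_rank w1 w2,
      exists2 v1, before le1 v1 w1 & same_rank v1 w2
    | exists2 v2, before le2 v2 w2 & same_rank w1 v2].
Proof.
elim/(wo_ind wo1): w1 w2 => w1 IH1; elim/(wo_ind wo2) => w2 IH2.
have [E1|/existsNP[v1 /not_implyP[v1w1 nE]]] := pselect
    (forall v1, before le1 v1 w1 -> exists2 v2, before le2 v2 w2 & same_rank v1 v2);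
  last first.
  case: (IH1 v1 v1w1 w2) => [m|[u1 u1v1 m]|//]; constructor 2; first by exists v1.
  by exists u1 => //; apply: before_trans v1w1.
have [E2|/existsNP[v2 /not_implyP[v2w2 nE]]] := pselect
    (forall v2, before le2 v2 w2 -> exists2 v1, before le1 v1 w1 & same_rank v1 v2).
  by constructor 1; constructor.
case: (IH2 v2 v2w2) => [m|//|[u2 u2v2 m]]; constructor 3; first by exists v2.
by exists u2 => //; apply: before_trans v2w2.
Qed.

Lemma same_rank_injl u v w : same_rank u w -> same_rank v w -> u = v.
Proof.
suff H x : forall u v, same_rank u x -> same_rank v x -> before le1 u v -> False.
  by move=> uw vw; have [//|/(H w)|/(H w)] := trichotomy wo1 u v; do ?case.
elim/(wo_ind wo2): x => {u v w}w IH u v [_ E1] [E2 _] uv.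
have [w' w'w m] := E2 u uv; have [u' u'u m'] := E1 w' w'w.
exact: IH m' m u'u.
Qed.

End SameRank.

Lemma same_rank_sym (W1 W2 : eqType) (le1 : rel W1) (le2 : rel W2) w1 w2 :
  well_order le1 ->
  same_rank le1 le2 w1 w2 -> same_rank le2 le1 w2 w1.
Proof.
move=> wo1; elim/(wo_ind wo1): w1 w2 => w1 IH w2 [E1 E2].
split=> [v2 /E2[v1 v1w1 m]|v1 v1w1]; first by exists v1 => //; exact: IH.
by have [v2 v2w2 m] := E1 v1 v1w1; exists v2 => //; exact: IH.
Qed.

Lemma same_rank_before (W1 W2 : eqType) (le1 : rel W1) (le2 : rel W2) u1 v1 u2 v2 :
  well_order le1 -> well_order le2 ->
  same_rank le1 le2 u1 u2 -> same_rank le1 le2 v1 v2 ->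
  before le1 u1 v1 -> before le2 u2 v2.
Proof.
move=> wo1 wo2 mu [E1 _] /E1[v vv2 mv].
by rewrite (same_rank_injl wo2 wo1 (same_rank_sym wo1 mu) (same_rank_sym wo1 mv)).
Qed.

(** A computation may choose its well-order freely, so determinism has to compare runs along two of
    them. *)
Lemma run_from_unique (C O : Type) (bit : O -> C -> bool) (st : C -> C)
    (isl : C -> Prop) (W1 W2 : eqType) (le1 : rel W1) (le2 : rel W2)
    (r1 : W1 -> C) (r2 : W2 -> C) c w1 w2 :
    (forall c c', isl c -> isl c' -> (forall o, bit o c = bit o c') -> c = c') ->
    well_order le1 -> well_order le2 ->
    run_from bit st isl le1 r1 c -> run_from bit st isl le2 r2 c ->
  same_rank le1 le2 w1 w2 -> r1 w1 = r2 w2.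
Proof.
move=> ext wo1 wo2 run1 run2.
elim/(wo_ind wo1): w1 w2 => w1 IH w2 [E1 E2].
have mono := same_rank_before wo1 wo2.
have mono' u1 v1 u2 v2 : same_rank le1 le2 u1 u2 -> same_rank le1 le2 v1 v2 ->
    before le2 u2 v2 -> before le1 u1 v1.
  by move=> /(same_rank_sym wo1) m1 /(same_rank_sym wo1) m2; apply: same_rank_before m1 m2.
have [run10 run1n] := run1 w1; have [run20 run2n] := run2 w2.
case: (stage_cases le1 w1) => [z1|[v1 s1]|l1].
- by rewrite run10 // run20 // => v2 /E2[v1 /z1].
- have [v1w1 nb] := s1; have [v2 v2w2 m] := E1 v1 v1w1.
  have s2 : succ_stage le2 v2 w2.
    split=> // u2 [v2u2 /[dup] /E2[u1 u1w1 mu] _].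
    by apply: (nb u1); split=> //; exact: mono' v2u2.
  move: (run1n (fun z => z _ v1w1)) => /(after_succ _ _ _ _ _ wo1 s1) ->.
  move: (run2n (fun z => z _ v2w2)) => /(after_succ _ _ _ _ _ wo2 s2) ->.
  by rewrite (IH v1 v1w1 v2 m).
have [nz1 ns1] := l1.
have l2 : limit_stage le2 w2.
  split=> [z2|v2 [v2w2 nb]].
    by apply: nz1 => v1 /E1[v2 /z2].
  have [v1 v1w1 m] := E2 v2 v2w2; apply: (ns1 v1); split=> // u1 [v1u1 u1w1].
  have [u2 u2w2 mu] := E1 u1 u1w1; apply: (nb u2); split=> //; exact: mono v1u1.
move: (run1n nz1) => /(after_limit _ _ _ _ _ wo1 l1)[lc1 b1].
move: (run2n l2.1) => /(after_limit _ _ _ _ _ wo2 l2)[lc2 b2].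
apply: ext => // o; apply/idP/idP.
  move=> /b1 cof; apply/b2 => v2 /E2[v1 v1w1 m].
  have [u1 [u1w1 vu1 ou1]] := cof v1 v1w1; have [u2 u2w2 mu] := E1 u1 u1w1.
  exists u2; split=> //; last by rewrite -(IH u1 u1w1 u2 mu).
  by rewrite -beforeN; apply: contraL vu1 => /(mono' _ _ _ _ mu m); rewrite /before.
move=> /b2 cof; apply/b1 => v1 /[dup] v1w1 /E1[v2 v2w2 m].
have [u2 [u2w2 vu2 ou2]] := cof v2 v2w2; have [u1 u1w1 mu] := E2 u2 u2w2.
exists u1; split=> //; last by rewrite (IH u1 u1w1 u2 mu).
by rewrite -beforeN; apply: contraL vu2 => /(mono _ _ _ _ mu m); rewrite /before.
Qed.

(** * Simulations that respect limsups *)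

Section Simulation.
Variables (C1 O1 : Type) (bit1 : O1 -> C1 -> bool) (st1 : C1 -> C1) (isl1 : C1 -> Prop).
Variables (C2 O2 : Type) (bit2 : O2 -> C2 -> bool) (st2 : C2 -> C2) (isl2 : C2 -> Prop).
Variables (P1 : C1 -> Prop) (P2 : C2 -> Prop) (enc lenc : C1 -> C2).
Local Notation reach1 := (reach bit1 st1 isl1).
Local Notation reach2 := (reach bit2 st2 isl2).
Local Notation agree o d c := (bit2 o d = bit2 o c).

Hypothesis sim_step : forall c, P1 c ->
  reach2 (fun d => P2 d /\ forall o, agree o d (enc c) \/ agree o d (enc (st1 c)))
    (enc c) (enc (st1 c)).
(** At a limit the simulating machine is in its own limit state: it arrives at [lenc c], with the
    right bits, and must first recover [enc c]. *)
Hypothesis sim_limit : forall c, isl1 c ->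
  [/\ isl2 (lenc c), forall o, agree o (lenc c) (enc c)
    & reach2 (fun d => P2 d /\ forall o, agree o d (enc c)) (lenc c) (enc c)].
(* Each bit of the simulating machine is frozen or copies a bit of the simulated
   one, and by [sim_step] it takes no third value in between; hence limsups
   agree. *)
Hypothesis sim_bit : forall o2,
  (exists b, forall c, bit2 o2 (enc c) = b) \/
  (exists o1, forall c, bit2 o2 (enc c) = bit1 o1 c).

Lemma limit_of_enc (W : eqType) (le : rel W) (D : W -> Prop) (r : W -> C1)
    (V : W -> C2 -> Prop) c :
    (exists w, D w) ->
    (forall v, D v -> exists v', [/\ D v', le v v' & r v' = st1 (r v)]) ->
    (forall v, D v -> exists2 d, V v d & forall o, agree o d (enc (r v))) ->
    (forall v d, D v -> V v d ->
       forall o, agree o d (enc (r v)) \/ agree o d (enc (st1 (r v)))) ->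
    well_order le ->
    limit_of bit1 isl1 le D (fun o u => bit1 o (r u)) c ->
  limit_of bit2 isl2 le D (fun o k => exists2 d, V k d & bit2 o d) (lenc c).
Proof.
move=> [w0 D0] Dsucc Venc VE wo [lc bc].
have [llc agr _] := sim_limit lc; split=> // o; rewrite agr.
have [[b ob]|[o1 trk]] := sim_bit o.
  rewrite ob; split=> [bt v Dv|/(_ w0 D0)[u [Du _ [d Vd]]]].
    have [d Vd dE] := Venc v Dv; exists v; split=> //; first exact: (wo_refl wo).
    by exists d => //; rewrite dE ob.
  by have [] := VE _ _ Du Vd o => ->; rewrite ?ob.
rewrite trk bc; split=> cof v Dv; have [u [Du vu]] := cof v Dv.
  have [d Vd dE] := Venc u Du; rewrite -trk => ou.
  by exists u; split=> //; exists d => //; rewrite dE.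
move=> [d Vd od]; have [u' [Du' uu' ru']] := Dsucc u Du.
have [] := VE _ _ Du Vd o => dE; rewrite dE trk in od; first by exists u.
by exists u'; split=> //; [exact: (wo_trans wo) uu'|rewrite ru'].
Qed.

Lemma simulation a b : reach1 P1 a b -> reach2 P2 (enc a) (enc b).
Proof.
move=> [V [W [le [r [wo [w0] run aft VE]]]] VP].
have P1r w : P1 (r w) by apply: VP; apply/VE; exists w.
(* Block [w] simulates the step taken at stage [w]; at a limit stage it begins with the recovery. *)
pose s w := if `[< limit_stage le w >] then lenc (r w) else enc (r w).
have run_lim w : limit_stage le w ->
    limit_of bit1 isl1 le (fun u => before le u w) (fun o u => bit1 o (r u)) (r w).
  by move=> lw; have [_ /(_ lw.1)/(after_limit _ _ _ _ _ wo lw)] := run w.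
have run_succ v w : succ_stage le v w -> r w = st1 (r v).
  by move=> sw; have [_ /(_ (fun z => z v sw.1))/(after_succ _ _ _ _ _ wo sw)] := run w.
pose Q w d := P2 d /\ forall o, agree o d (enc (r w)) \/ agree o d (enc (st1 (r w))).
have sr w : reach2 (Q w) (s w) (enc (st1 (r w))).
  rewrite /s; case: asboolP => [lw|_]; last exact: sim_step.
  apply: reach_trans (sim_step (P1r w)).
  have [_ _] := sim_limit (run_lim w lw).1.
  by apply: reach_weaken => d [Pd dE]; split=> // o; left.
have [U pU] := choice (fun w => let: ex_intro2 U p UQ := sr w in ex_intro _ U (conj p UQ)).
have UQ w d : U w d -> Q w d by case: (pU w) => _; apply.
have Uenc w : exists2 d, U w d & forall o, agree o d (enc (r w)).
  exists (s w); first exact: passage_start (pU w).1.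
  rewrite /s; case: asboolP => // lw; by case: (sim_limit (run_lim w lw).1).
have sum c : (forall i, (forall j, le j i) -> c = enc (st1 (r i))) ->
    ((forall i, exists j, before le i j) ->
      limit_of bit2 isl2 le (fun _ => True) (fun o k => exists2 d, U k d & bit2 o d) c) ->
    reach2 P2 (enc a) c.
  move=> ctop clim; exists (fun d => exists w, U w d); last by move=> d [w /UQ[]].
  apply: (@passage_sum _ _ _ _ _ _ le U s (fun w => enc (st1 (r w)))) => //.
  - by move=> w; case: (pU w).
  - move=> w z; rewrite /s; case: asboolP => [[]//|_].
    by have [-> ] := run w.
  - move=> v w sw; rewrite /s; case: asboolP => [[_ /(_ v)]//|_].
    by rewrite (run_succ v).
  - move=> w lw; rewrite /s; case: asboolP => // _.
    apply: limit_of_enc (run_lim w lw) => //.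
    + apply: contrapT => ne; case: lw.1 => v vw; by apply: ne; exists v.
    + move=> v vw; have [u vu uw] := limit_between lw vw.
      have [v' sv v'u] := ex_succ_stage wo vu; exists v'; split.
      * exact: le_before_trans uw.
      * exact: (beforeW wo sv.1).
      * exact: run_succ.
    + by move=> v d _ /UQ[].
have [[t top]|ntop] := pselect (exists t, forall v, le v t).
  apply: sum => [i itop|/(_ t)[j]]; last by rewrite /before top.
  rewrite (aft.1 t) // (_ : i = t) //.
  by apply: (wo_anti wo) (top i) (itop t).
have next v : exists2 u, True & before le v u.
  apply: contrapT => nu; apply: ntop; exists v => u.
  by rewrite -(beforeN le); apply/negP => vu; apply: nu; exists u.
(* Without a last stage [b] is itself a limit: the blocks lead only to [lenc b], and one more
   recovery follows. *)
have lb := aft.2 (fun v _ => next v).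
have [_ _ lr] := sim_limit lb.1.
apply: reach_trans (reach_weaken _ lr) => [|d [] //].
apply: sum => [i itop|_]; first by case: ntop; exists i.
apply: limit_of_enc lb => //.
- move=> v _; have [u _ vu] := next v.
  have [v' sv v'u] := ex_succ_stage wo vu; exists v'; split=> //.
    exact: (beforeW wo sv.1).
  exact: run_succ.
- by move=> v d _ /UQ[].
Qed.

End Simulation.

(** * Runs of programs *)

Inductive tape_name := InputTape | ScratchTape | OutputTape.

Section ProgramRuns.
Variable p : program.
Implicit Types (c : config p) (x y : real).

Definition tape_bit (o : tape_name * nat) c : bool :=
  match o.1 with
  | InputTape => input_tape c o.2
  | ScratchTape => scratch_tape c o.2
  | OutputTape => output_tape c o.2
  end.

Definition at_limit c : Prop := state c = limit_state p /\ head_pos c = 0.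
Definition running c : Prop := state c <> halt_state p.
Definition preach := reach tape_bit (@step p) at_limit.

Lemma config_ext c c' : state c = state c' -> head_pos c = head_pos c' ->
  (forall o, tape_bit o c = tape_bit o c') -> c = c'.
Proof.
case: c c' => [q h a s b] [q' h' a' s' b'] /= <- <- e.
congr Config; apply/funext => i.
- exact: (e (InputTape, i)).
- exact: (e (ScratchTape, i)).
- exact: (e (OutputTape, i)).
Qed.

Lemma limit_configP (W : eqType) (le : rel W) (r : W -> config p) w :
  limit_config le r w <->
  limit_of tape_bit at_limit le (fun u => before le u w)
    (fun o u => tape_bit o (r u)) (r w).
Proof.
have e (h : W -> bool) b : is_limsup le h w b <->
    (b <-> cofinal_in le (fun u => before le u w) h).
  suff <- : (forall v, before le v w ->
      exists u, [/\ le v u, before le u w & h u]) =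
    cofinal_in le (fun u => before le u w) h by [].
  by apply/propext; split=> cof v /cof[u [? ? ?]]; exists u; split.
split=> [[sl hl il sc ol]|[[sl hl] bl]].
  by split=> // -[[] i]; [have/e := il i|have/e := sc i|have/e := ol i].
by split=> // i; apply/e; [exact: (bl (InputTape, i))|exact: (bl (ScratchTape, i))|
  exact: (bl (OutputTape, i))].
Qed.

Lemma is_runP (W : eqType) (le : rel W) (r : W -> config p) x :
  well_order le ->
  is_run le x r <-> run_from tape_bit (@step p) at_limit le r (init_config p x).
Proof.
move=> wo; split=> [[r0 rS rL] w|run].
  split=> [/r0//|nz]; case: (stage_cases le w) => [//|[v sw]|lw].
    by apply/(after_succ _ _ _ _ _ wo sw)/rS.
  by apply/(after_limit _ _ _ _ _ wo lw)/limit_configP/rL.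
split=> [w zw|v w sw|w lw]; first by have [->] := run w.
  by have [_ /(_ (fun z => z v sw.1))/(after_succ _ _ _ _ _ wo sw)] := run w.
by apply/limit_configP; have [_ /(_ lw.1)/(after_limit _ _ _ _ _ wo lw)] := run w.
Qed.

Lemma computes_preach x y : computes p x y ->
  exists c, [/\ preach running (init_config p x) c, state c = halt_state p
              & output_tape c = y].
Proof.
move=> [W [le [r [w [wo /(is_runP _ _ wo) run hw nh oy]]]]].
exists (r w); split=> //.
(* A passage has to be nonempty; the start state differs from the halt state. *)
have nz : ~ zero_stage le w.
  move=> z; have [+ _] := run w => /(_ z) rw; move: hw; rewrite rw /= => e.
  by have := special_uniq p; rewrite /= !inE e eqxx.
exists (fun c => exists2 v, before le v w & r v = c); last by move=> d [v /nh vw <-].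
pose T := {v : W | before le v w}.
pose leT : rel T := fun u v => le (val u) (val v).
have woT : well_order leT.
  apply: mk_well_order => [u v uv vu|P [u Pu]].
    by apply/val_inj/(wo_anti wo).
  have [|v [vw Pv] vmin] := @wo_min _ _ wo (fun v => exists vw : before le v w, P (exist _ v vw)).
    by case: u Pu => u uw Pu; exists u, uw.
  by exists (exist _ v vw) => // -[t tw] Pt; apply: vmin; exists tw.
exists T, leT, (fun u => r (val u)); split=> //.
- by apply: contrapT => nT; apply: nz => v vw; apply: nT; constructor; exists v.
- move=> [u uw]; split=> [z|nzu].
    have [-> //] := run u; move=> v vu; apply: (z (exist _ v (before_trans wo vu uw))).
    exact: vu.
  have [_] := run u => aft; rewrite /=.
  apply/(@after_embed _ _ _ _ _ _ _ _ le val _ (fun v => before le v u)) => //.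
    move=> v; split=> [vu|[v' v'u <-] //].
    by exists (exist _ v (before_trans wo vu uw)).
  apply: aft => zu; apply: nzu => -[v vw]; exact: zu.
- apply/(@after_embed _ _ _ _ _ _ _ _ le val _ (fun v => before le v w)) => //.
    by move=> v; split=> [vw|[[v' v'w] _ <-] //]; exists (exist _ v vw).
  by have [_] := run w; apply.
- move=> c; split=> [[v vw <-]|[[v vw] <-]]; first by exists (exist _ v vw).
  by exists v.
Qed.

Lemma preach_computes x c : preach running (init_config p x) c ->
  state c = halt_state p -> computes p x (output_tape c).
Proof.
move=> [V [W [le [r [wo [w0] run aft VE]]]] VP] hc.
(* [None] is a new last stage, carrying the halting configuration. *)
pose leo : rel (option W) := fun u v =>
  match u, v with
  | Some u, Some v => le u v
  | _, None => true
  | None, Some _ => false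
  end.
have woo : well_order leo.
  apply: mk_well_order => [[u|] [v|] //= uv vu|P [u Pu]].
    by rewrite (wo_anti wo uv vu).
  have [[v Pv]|nP] := pselect (exists v, P (Some v)).
    have [|t Pt tmin] := @wo_min _ _ wo (fun v => P (Some v)); first by exists v.
    by exists (Some t) => // -[z|] //; exact: tmin.
  exists None => [|[v|] // Pv]; last by case: nP; exists v.
  by case: u Pu => // v Pv; case: nP; exists v.
pose r' u := if u is Some v then r v else c.
have emb (D : W -> Prop) (D2 : option W -> Prop) d :
    (forall v, D2 v <-> exists2 u, D u & Some u = v) ->
    after tape_bit (@step p) at_limit le D r d ->
    after tape_bit (@step p) at_limit leo D2 r' d.
  move=> DE; apply: (iffLR (@after_embed _ _ _ _ _ _ _ le leo Some D D2 r' d _ DE)) => //.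
exists (option W), leo, r', None; split=> //.
- apply/is_runP => // -[w|]; split=> [z|nz].
  + case: (run w) => + _; apply=> v; exact: (z (Some v)).
  + have [_] := run w => aftw; apply: (emb (fun v => before le v w)).
      move=> [v|]; split=> //; last by case.
        by move=> vw; exists v.
      by case=> u uw [<-].
    by apply: aftw => z; apply: nz => -[v|] //; exact: z.
  + by case: (z (Some w0)).
  + apply: emb aft => -[v|]; split=> //; last by case.
    by exists v.
- by move=> [v|] // _; apply: VP; apply/VE; exists v.
Qed.

(** Were the halting stages of different rank, the later one would be preceded by a stage matching
    the earlier one, hence already halted. *)
Lemma computes_uniq x y1 y2 : computes p x y1 -> computes p x y2 -> y1 = y2.
Proof.
move=> [W1 [le1 [r1 [w1 [wo1 /(is_runP _ _ wo1) run1 h1 n1 <-]]]]].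
move=> [W2 [le2 [r2 [w2 [wo2 /(is_runP _ _ wo2) run2 h2 n2 <-]]]]].
have same v1 v2 : same_rank le1 le2 v1 v2 -> r1 v1 = r2 v2.
  apply: run_from_unique run1 run2 => // c c' [s1 p1] [s2 p2].
  by apply: config_ext; rewrite ?s1 ?p1.
have [/same -> //|[v1 v1w1 /same e]|[v2 v2w2 /same e]] := same_rank_total wo1 wo2 w1 w2.
- by have := n1 v1 v1w1; rewrite e h2.
- by have := n2 v2 v2w2; rewrite -e h1.
Qed.

Lemma computes_it_computable (f : real -> real) :
  (forall x, computes p x (f x)) -> it_computable f.
Proof.
move=> pf; exists p => x y; split=> [pxy|-> //].
exact: computes_uniq pxy (pf x).
Qed.

End ProgramRuns.

(** * Simulating many tracks on three tapes *)

Definition triple : Type := bool * bool * bool.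

Definition upd (T : Type) (t : nat -> T) (i : nat) (s : T) : nat -> T :=
  fun j => if j == i then s else t j.

Lemma upd_same (T : Type) (t : nat -> T) i : upd t i (t i) = t.
Proof. by apply/funext => j; rewrite /upd; case: eqP => [->|]. Qed.

Definition tape_config (p : program) (q : states p) (h : nat) (T : nat -> triple) : config p :=
  Config q h (fun i => (T i).1.1) (fun i => (T i).1.2) (fun i => (T i).2).

Lemma step_tape_config (p : program) (q : states p) h T :
  step (tape_config q h T) = let: (q', s, d) := transition q (T h) in
    tape_config q' (move d h) (upd T h s).
Proof.
rewrite /step /tape_config /=; case: (T h) => [[a b] o] /=.
case: (transition q (a, b, o)) => [[q' [[a' b'] o']] d] /=.
by congr Config; apply/funext => i; rewrite /write /upd; case: ifP.
Qed.

Definition triple_bit (t : tape_name) (s : triple) : bool :=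
  match t with InputTape => s.1.1 | ScratchTape => s.1.2 | OutputTape => s.2 end.

Lemma tape_bit_tape_config (p : program) (q : states p) h T o :
  tape_bit o (tape_config q h T) = triple_bit o.1 (T o.2).
Proof. by case: o => -[]. Qed.

Section TrackMachine.
Variables (D Q : finType).
Local Notation G := {ffun D -> bool}.

Record track_config := TConfig { tstate : Q; tpos : nat; ttape : nat -> G }.

(* The booleans returned by delta are directions: true is right. *)
Variables (qstart qlim qhalt : Q) (delta : Q -> G -> Q * G * bool).
Variables (din dout : D).

Definition tmove (right : bool) (i : nat) : nat := if right then i.+1 else i.-1.

Definition tstep (c : track_config) : track_config :=
  let: (q, s, d) := delta (tstate c) (ttape c (tpos c)) in
  TConfig q (tmove d (tpos c)) (upd (ttape c) (tpos c) s).

Definition tbit (o : D * nat) (c : track_config) : bool := ttape c o.2 o.1.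
Definition tat_limit (c : track_config) : Prop := tstate c = qlim /\ tpos c = 0.
Definition trunning (c : track_config) : Prop := tstate c <> qhalt.
Definition treach := reach tbit tstep tat_limit.
Definition tinit (x : real) : track_config :=
  TConfig qstart 0 (fun i => [ffun d => (d == din) && x i]).

(* Track d of cell i is kept at position width * i + offset d of the scratch
   tape.  Offsets 0 and 1 are left free so that, in the zigzag, the far mark
   always lies beyond the near one. *)
Definition width : nat := #|D|.+2.
Local Notation M := width.
Definition offset (d : D) : nat := (enum_rank d).+2.

Lemma offset_lt d : offset d < M.
Proof. by rewrite /offset /width !ltnS. Qed.

Lemma offset_inj : injective offset.
Proof. by move=> d e [] /val_inj/enum_rank_inj. Qed.

Definition track_at (j : nat) : option D := [pick d | offset d == j].

Lemma track_at_offset d : track_at (offset d) = Some d.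
Proof.
rewrite /track_at; case: pickP => [e /eqP/offset_inj -> //|/(_ d)].
by rewrite eqxx.
Qed.

Lemma track_at_Some j d : track_at j = Some d -> j = offset d.
Proof. by rewrite /track_at; case: pickP => // e /eqP <- [->]. Qed.

(* A zigzag moves bits between position i and position [target u i], for
   i = 0, 1, 2, ...: from input to scratch tape if u is false, from scratch to
   output tape if u is true.  Position i and the target are marked on the tape
   that is otherwise blank: the output tape, respectively the input tape. *)
Definition zigzag_states : finType := (bool * bool * 'I_5 * 'I_M.+1)%type.
Definition sim_states : finType := (Q * G * bool * 'I_(3 * M).+1)%type.
Definition raw_state : finType := ('I_4 + zigzag_states + sim_states)%type.

(** Numbers 0, 1, 2 are the start, limit and halt state; 3 opens the collection of the output. *)
Definition special_state (k : nat) : raw_state := inl (inl (inord k)).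
Definition zigzag_state (u cy : bool) (k j : nat) : raw_state :=
  inl (inr (u, cy, inord k, inord j)).
Definition sim_state (q : Q) (s : G) (d : bool) (k : nat) : raw_state :=
  inr (q, s, d, inord k).

Definition sim_start (q : Q) : raw_state :=
  if q == qhalt then special_state 3 else sim_state q [ffun=> false] false 0.

Definition mark (u : bool) (s : triple) : bool := if u then s.1.1 else s.2.
Definition set_mark (u : bool) (s : triple) : triple :=
  if u then (true, s.1.2, s.2) else (s.1.1, s.1.2, true).
(** The bit [cy] is carried outwards for [u = false], taken in [near2] and delivered in [far]; it is
    carried inwards for [u = true], taken in [far] and delivered in [near1]. *)
Definition near1 (u cy : bool) (s : triple) : triple :=
  if u then (false, s.1.2, cy) else (s.1.1, s.1.2, false).
Definition near2 (u cy : bool) (s : triple) : bool * triple :=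
  if u then (cy, (true, s.1.2, s.2)) else (s.1.1, (false, s.1.2, true)).
Definition far (u cy : bool) (s : triple) : bool * triple :=
  if u then (s.1.2, (false, s.1.2, s.2)) else (cy, (s.1.1, cy, false)).

Definition base (u : bool) : nat := offset (if u then dout else din).

(** Distances between consecutive targets are bounded and are counted by [j] ([k] = 0, 1); the
    distance from [i] to its target is not, so the walks back (2) and out again (4) look for marks.
    State 3 sets the near mark one cell further. *)
Definition zigzag_trans (u cy : bool) (k j : nat) (s : triple) :
    raw_state * triple * direction :=
  let do_far := (zigzag_state u (far u cy s).1 1 1, (far u cy s).2, MoveRight) in
  match k with
  | 0 => if j == base u then do_far else (zigzag_state u cy 0 j.+1, s, MoveRight)
  | 1 => if j == M then (zigzag_state u cy 2 0, set_mark u s, MoveLeft)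
         else (zigzag_state u cy 1 j.+1, s, MoveRight)
  | 2 => if mark u s then (zigzag_state u cy 3 0, near1 u cy s, MoveRight)
         else (zigzag_state u cy 2 0, s, MoveLeft)
  | 3 => (zigzag_state u (near2 u cy s).1 4 0, (near2 u cy s).2, MoveRight)
  | _ => if mark u s then do_far else (zigzag_state u cy 4 0, s, MoveRight)
  end.

(* One step of the simulated machine takes 3 * width steps: read the block moving
   right, write it moving left, then walk one block to the left or right. *)
Definition sim_trans (q : Q) (b : G) (d : bool) (k : nat) (s : triple) :
    raw_state * triple * direction :=
  if k < M then
    (sim_state q [ffun e => if offset e == k then s.1.2 else b e] d k.+1, s, MoveRight)
  else if k == M then
    let: (q', b', d') := delta q b in (sim_state q' b' d' k.+1, s, MoveLeft)
  else if k < 2 * M then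
    (sim_state q b d k.+1,
     (s.1.1, if track_at (2 * M - k) is Some e then b e else s.1.2, s.2),
     MoveLeft)
  else
    (if k.+1 < 3 * M then sim_state q b d k.+1 else sim_start q, s,
     if d then MoveRight else MoveLeft).

(* At a limit, the bits of the input and scratch tape at position 0 tell what was
   going on: scratch 0, spreading the input; scratch 1 and input 1, the
   simulation; scratch 1 and input 0, collecting the output. *)
Definition raw_trans (r : raw_state) (s : triple) : raw_state * triple * direction :=
  match r with
  | inl (inl k) =>
    match nat_of_ord k with
    | 0 => (zigzag_state false s.1.1 0 1, (false, s.1.2, true), MoveRight)
    | 1 => if ~~ s.1.2 then (sim_start qstart, (true, true, s.2), MoveLeft)
           else if s.1.1 then (sim_start qlim, s, MoveLeft)
           else (special_state 2, s, MoveLeft)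
    | 2 => (special_state 2, s, MoveLeft)
    | _ => (zigzag_state true false 0 1, s, MoveRight)
    end
  | inl (inr (u, cy, k, j)) => zigzag_trans u cy k j s
  | inr (q, b, d, k) => sim_trans q b d k s
  end.

Lemma special_state_inj k l : k < 4 -> l < 4 -> special_state k = special_state l -> k = l.
Proof. by move=> k4 l4 [] /(congr1 (@nat_of_ord 4)); rewrite !inordK. Qed.

Lemma special_uniq_proof : uniq [:: special_state 0; special_state 2; special_state 1].
Proof.
have ne k l : k < 4 -> l < 4 -> k != l -> (special_state k == special_state l) = false.
  by move=> k4 l4; apply: contra_neqF => /eqP/special_state_inj; apply.
by rewrite /= !inE !ne.
Qed.

Definition raw_program : program :=
  @Program raw_state (special_state 0) (special_state 2) (special_state 1)
    special_uniq_proof raw_trans.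
Local Notation P := raw_program.
Local Notation conf q h T := (@tape_config P q h T).

Lemma step_special k h T : k < 4 ->
  step (conf (special_state k) h T) =
    let: (q', s, d) :=
      match k with
      | 0 => (zigzag_state false (T h).1.1 0 1, (false, (T h).1.2, true), MoveRight)
      | 1 => if ~~ (T h).1.2 then (sim_start qstart, (true, true, (T h).2), MoveLeft)
             else if (T h).1.1 then (sim_start qlim, T h, MoveLeft)
             else (special_state 2, T h, MoveLeft)
      | 2 => (special_state 2, T h, MoveLeft)
      | _ => (zigzag_state true false 0 1, T h, MoveRight)
      end in conf q' (move d h) (upd T h s).
Proof.
move=> k4; rewrite step_tape_config [transition _ _]/(raw_trans _ _) /raw_trans.
by rewrite /special_state inordK.
Qed.

Lemma step_zigzag u cy k j h T : k < 5 -> j <= M ->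
  step (conf (zigzag_state u cy k j) h T) =
    let: (q', s, d) := zigzag_trans u cy k j (T h) in
    conf q' (move d h) (upd T h s).
Proof.
move=> k5 jM; rewrite step_tape_config [transition _ _]/(raw_trans _ _) /raw_trans.
by rewrite /zigzag_state !inordK.
Qed.

Lemma step_sim q b d k h T : k <= 3 * M ->
  step (conf (sim_state q b d k) h T) =
    let: (q', s, d) := sim_trans q b d k (T h) in
    conf q' (move d h) (upd T h s).
Proof.
move=> kM; rewrite step_tape_config [transition _ _]/(raw_trans _ _) /raw_trans.
by rewrite /sim_state !inordK.
Qed.

Lemma running_zigzag u cy k j h T : running (conf (zigzag_state u cy k j) h T).
Proof. by []. Qed.

Lemma running_special k h T : k < 4 -> k != 2 -> running (conf (special_state k) h T).
Proof. by move=> k4 k2; rewrite /running /= => /special_state_inj-/(_ k4 isT); apply/eqP. Qed.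

Definition target (u : bool) (i : nat) : nat := M * i + base u.

(** * The zigzag between a tape and its spread-out copy *)

Section Zigzag.
Variables (u : bool) (R : config P -> Prop).
Local Notation preach := (preach (p := P)).

Lemma zigzag_init cy T :
    (forall k j h, R (conf (zigzag_state u cy k j) h T)) ->
  preach R (conf (zigzag_state u cy 0 1) 1 T)
    (conf (zigzag_state u (far u cy (T (target u 0))).1 1 1) (target u 0).+1
      (upd T (target u 0) (far u cy (T (target u 0))).2)).
Proof.
move=> RT; have bu : base u < M by exact: offset_lt.
have b2 : 1 < base u by [].
have t0 : target u 0 = base u by rewrite /target muln0.
apply: (@reach_trans _ _ _ _ _ _ _ (conf (zigzag_state u cy 0 (base u)) (base u) T)).
  have := @reach_iter _ _ (@tape_bit P) (@step P) (@at_limit P) R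
    (fun m => conf (zigzag_state u cy 0 m.+1) m.+1 T) (base u).-1.
  rewrite (_ : (base u).-1.+1 = base u) ?(ltn_predK b2) //; apply; last lia.
  move=> m mb; split=> //; rewrite step_zigzag //; last lia.
  rewrite /zigzag_trans (_ : (m.+1 == base u) = false); last lia.
  by rewrite upd_same.
rewrite t0; have := reach_step (@tape_bit P) (@step P) (@at_limit P)
  (RT 0 (base u) (base u)).
by rewrite step_zigzag ?(ltnW bu) // /zigzag_trans eqxx.
Qed.

(** [T1], [T2], [T3] are the tapes after setting the far mark, erasing the near mark, and setting it
    again at [i.+1]. *)
Lemma zigzag_cycle cy i T :
    (forall q, mark u (T q) = (q == i)) ->
  let t := target u i.+1 in
  let T1 := upd T t (set_mark u (T t)) in
  let T2 := upd T1 i (near1 u cy (T1 i)) in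
  let n2 := near2 u cy (T2 i.+1) in
  let T3 := upd T2 i.+1 n2.2 in
  let f := far u n2.1 (T3 t) in
    (forall c k j h T', T' = T \/ T' = T1 \/ T' = T2 \/ T' = T3 ->
       R (conf (zigzag_state u c k j) h T')) ->
  preach R (conf (zigzag_state u cy 1 1) (target u i).+1 T)
    (conf (zigzag_state u f.1 1 1) t.+1 (upd T3 t f.2)).
Proof.
move=> mT t T1 T2 n2 T3 f RT.
have bu : base u < M by exact: offset_lt.
have b2 : 1 < base u by [].
have tE : t = target u i + M by rewrite /t /target mulnS; lia.
have ti : i.+2 < t by rewrite /t /target mulnS; nia.
have m1 q : mark u (T1 q) = (q == i) || (q == t).
  rewrite /T1 /upd; have [->|_] := eqVneq q t; last by rewrite mT orbF.
  by rewrite orbT /mark /set_mark; case: (u).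
have m3 q : mark u (T3 q) = (q == i.+1) || (q == t).
  rewrite /T3 /n2 /upd; have [->|qi1] := eqVneq q i.+1.
    by rewrite /mark /near2; case: (u).
  rewrite /T2 /upd; have [->|qi] := eqVneq q i; last by rewrite m1 (negbTE qi).
  by rewrite /mark /near1; case: (u) => /=; lia.
pose step1 := reach_step (@tape_bit P) (@step P) (@at_limit P).
have R0 c k j h : R (conf (zigzag_state u c k j) h T) by apply: RT; auto.
have R1 c k j h : R (conf (zigzag_state u c k j) h T1) by apply: RT; auto.
have R2 c k j h : R (conf (zigzag_state u c k j) h T2) by apply: RT; auto.
have R3 c k j h : R (conf (zigzag_state u c k j) h T3) by apply: RT; auto.
apply: (@reach_trans _ _ _ _ _ _ _ (conf (zigzag_state u cy 1 M) t T)).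
  have := @reach_iter _ _ (@tape_bit P) (@step P) (@at_limit P) R
    (fun m => conf (zigzag_state u cy 1 m.+1) (target u i + m.+1) T) M.-1.
  rewrite addn1 -tE; apply=> // m mM; split=> //; rewrite step_zigzag //; last lia.
  by rewrite /zigzag_trans (_ : (m.+1 == M) = false) ?upd_same ?addnS //; lia.
apply: (@reach_trans _ _ _ _ _ _ _ (conf (zigzag_state u cy 2 0) t.-1 T1)).
  by have := step1 _ _ (R0 cy 1 M t); rewrite step_zigzag // /zigzag_trans eqxx.
apply: (@reach_trans _ _ _ _ _ _ _ (conf (zigzag_state u cy 2 0) i T1)).
  have := @reach_iter _ _ (@tape_bit P) (@step P) (@at_limit P) R
    (fun m => conf (zigzag_state u cy 2 0) (t.-1 - m) T1) (t.-1 - i).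
  rewrite subn0 (_ : t.-1 - (t.-1 - i) = i); last lia.
  apply=> [m mt|]; last lia.
  split=> //; rewrite step_zigzag // /zigzag_trans m1.
  rewrite (_ : (_ == i) || _ = false) ?upd_same //; last lia.
  by congr tape_config; rewrite [move _ _]/(_.-1) subnS.
apply: (@reach_trans _ _ _ _ _ _ _ (conf (zigzag_state u cy 3 0) i.+1 T2)).
  by have := step1 _ _ (R1 cy 2 0 i); rewrite step_zigzag // /zigzag_trans m1 eqxx.
apply: (@reach_trans _ _ _ _ _ _ _ (conf (zigzag_state u n2.1 4 0) i.+2 T3)).
  by have := step1 _ _ (R2 cy 3 0 i.+1); rewrite step_zigzag.
apply: (@reach_trans _ _ _ _ _ _ _ (conf (zigzag_state u n2.1 4 0) t T3)).
  have := @reach_iter _ _ (@tape_bit P) (@step P) (@at_limit P) R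
    (fun m => conf (zigzag_state u n2.1 4 0) (i.+2 + m) T3) (t - i.+2).
  rewrite addn0 subnKC; last lia.
  apply=> [m mt|]; last lia.
  split=> //; rewrite step_zigzag // /zigzag_trans m3.
  by rewrite (_ : (_ == i.+1) || _ = false) ?upd_same ?addnS //; lia.
by have := step1 _ _ (R3 n2.1 4 0 t); rewrite step_zigzag // /zigzag_trans m3 eqxx orbT.
Qed.

End Zigzag.

Lemma target_mod u i : target u i %% M = base u.
Proof. by rewrite /target mulnC modnMDl modn_small //; exact: offset_lt. Qed.

Lemma target_div u i : target u i %/ M = i.
Proof. by rewrite /target mulnC divnMDl // divn_small ?addn0 //; exact: offset_lt. Qed.

Lemma eq_target u i p : (p == target u i) = (p %% M == base u) && (p %/ M == i).
Proof.
apply/eqP/andP => [->|[/eqP m /eqP d]]; first by rewrite target_mod target_div !eqxx.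
by rewrite (divn_eq p M) m d /target mulnC.
Qed.

Lemma lt_target u i : i.+1 < target u i.
Proof.
have b2 : 1 < base u by [].
by rewrite /target; have : i <= M * i; [apply: leq_pmull|lia].
Qed.

Local Notation preach := (preach (p := P)).

(* T i is the tape just after the i-th visit to the far mark, when that mark is
   erased; L is the tape at the limit. *)
Lemma reach_zigzag u (cy : nat -> bool) (T : nat -> nat -> triple) (L : nat -> triple) :
    (forall i q, mark u (T i q) = (q == i)) ->
    (forall i p, p < i -> T i p = L p) ->
    (forall i,
      let t := target u i.+1 in
      let T1 := upd (T i) t (set_mark u (T i t)) in
      let T2 := upd T1 i (near1 u (cy i) (T1 i)) in
      let n2 := near2 u (cy i) (T2 i.+1) in
      let T3 := upd T2 i.+1 n2.2 in
      far u n2.1 (T3 t) = (cy i.+1, T i.+1 t) /\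
      (forall p, p != t -> T3 p = T i.+1 p)) ->
  preach (@running P) (conf (zigzag_state u (cy 0) 1 1) (target u 0).+1 (T 0))
    (conf (special_state 1) 0 L).
Proof.
move=> mT TL Tcycle.
pose F i := conf (zigzag_state u (cy i) 1 1) (target u i).+1 (T i).
(* Cycle [i] touches only cells from [i] on, so every cell below [i] already has its limit value. *)
pose Qd i (d : config P) := running d /\
  forall o, o.2 < i -> tape_bit o d = triple_bit o.1 (L o.2).
apply: (@reach_omega _ _ _ _ _ (@running P) Qd F).
- move=> i; have := @zigzag_cycle u (Qd i) (cy i) i (T i) (mT i).
  have [/=] := Tcycle i.
  set T1 := upd (T i) _ _; set T2 := upd T1 _ _; set n2 := near2 _ _ _.
  set T3 := upd T2 _ _ => fE T3E.
  rewrite fE /= (_ : upd T3 _ _ = T i.+1); last first.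
    by apply/funext => p; rewrite /upd; case: eqVneq => [->|/T3E].
  apply=> c k j h T' T'E; split; first exact: running_zigzag.
  move=> [o p] /= pi; rewrite tape_bit_tape_config /= -(TL i) //; congr triple_bit.
  have pt := lt_target u i.+1.
  have e1 : T1 p = T i p by rewrite /T1 /upd; case: eqP => // ?; lia.
  have e2 : T2 p = T i p by rewrite /T2 /upd; case: eqP => // ?; lia.
  have e3 : T3 p = T i p by rewrite /T3 /upd; case: eqP => // ?; lia.
  by case: T'E => [|[|[|]]] ->.
- by move=> i d [].
- by [].
- move=> [o p]; exists p.+1 => k d pk [_ dL]; by rewrite dL //= tape_bit_tape_config.
Qed.

Definition raw_input (x : real) (p : nat) : triple :=
  (false, (p %% M == base false) && x (p %/ M), false).

Lemma reach_raw_input x :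
  preach (@running P) (init_config P x) (conf (special_state 1) 0 (raw_input x)).
Proof.
(* After delivery of bit [i]: the input is erased up to [i], bits 0 to [i] are in place, and the
   near mark stands at [i]. *)
pose T i p : triple := ((i < p) && x p,
  (p %% M == base false) && ((p %/ M <= i) && x (p %/ M)), p == i).
pose T0 p : triple := ((0 < p) && x p, false, p == 0).
have b2 : 1 < base false by [].
have init : preach (@running P) (init_config P x) (conf (zigzag_state false (x 0) 0 1) 1 T0).
  have -> : init_config P x = conf (special_state 0) 0 (fun p => (x p, false, false)) by [].
  have := reach_step (@tape_bit P) (@step P) (@at_limit P)
    (@running_special 0 0 (fun p => (x p, false, false)) isT isT).
  rewrite step_special //= (_ : upd _ _ _ = T0) //.
  by apply/funext => -[|p].
apply: reach_trans init _.
have := @zigzag_init false (@running P) (x 0) T0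
  (fun k j h => @running_zigzag false (x 0) k j h T0).
rewrite /= (_ : upd _ _ _ = T 0); last first.
  apply/funext => p; rewrite /upd eq_target /T /T0 /=.
  have [->|p0] := eqVneq p 0; first by rewrite mod0n div0n (_ : (0 == base false) = false).
  rewrite leqn0; case: eqVneq => [m|//]; case: eqVneq => [d|//] /=.
  have -> : target false 0 = p by apply/esym/eqP; rewrite eq_target m d !eqxx.
  by rewrite d.
move=> r; apply: reach_trans r _.
have -> : raw_input x = fun p => raw_input x p by [].
apply: (@reach_zigzag false x T).
- by [].
- move=> i p pi; rewrite /T /raw_input ltnNge (ltnW pi) /= (ltn_eqF pi).
  by rewrite (leq_trans (leq_div _ _) (ltnW pi)).
- move=> i /=.
  have lt := lt_target false i.+1; set t := target _ _ in lt *.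
  have tm : t %% M = base false by exact: target_mod.
  have td : t %/ M = i.+1 by exact: target_div.
  have ti : (t == i) = false by lia.
  have ti1 : (t == i.+1) = false by lia.
  have i1i : (i.+1 == i) = false by lia.
  have it : (i == t) = false by lia.
  have i1t : (i.+1 == t) = false by lia.
  split.
    rewrite /upd /T /= ti ti1 i1i i1t eqxx /= tm td !eqxx ltnSn /=.
    by have [-> ->] : (i < t) /\ (i.+1 < t) by split; lia.
  move=> p pt; rewrite /upd (negbTE pt) it i1t.
  have [->|pi1] := eqVneq p i.+1.
    rewrite i1i /T /= ltnn eqxx; congr (_, _, _).
    have d1 : i.+1 %/ M <= i by rewrite -ltnS ltn_Pdiv.
    by rewrite d1 (leqW d1).
  have dp : (p %% M == base false) && ((p %/ M <= i) && x (p %/ M)) =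
      (p %% M == base false) && ((p %/ M <= i.+1) && x (p %/ M)).
    case: eqVneq => //= m; rewrite [in RHS]leq_eqVlt ltnS.
    by case: eqVneq => // d; case/eqP: pt; apply/eqP; rewrite eq_target m d !eqxx.
  have [pi|pi] := eqVneq p i.
    by rewrite /T /= -pi; rewrite -pi in dp; rewrite dp; congr (_, _, _); lia.
  rewrite /T /= dp; congr (_, _, _); lia.
Qed.

(** The input bit at position 0, which flags limits of the simulation, doubles as the first near
    mark; the zigzag erases it, so the next limit is recognised as the end of the collection. *)
Lemma reach_gather (S : nat -> bool) :
  preach (@running P) (conf (special_state 3) 0 (fun p => (p == 0, S p, false)))
    (conf (special_state 1) 0 (fun p => (false, S p, S (target true p)))).
Proof.
pose y p := S (target true p).
pose T i p : triple := (p == i, S p, (p < i) && y p).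
have T0E : (fun p => (p == 0, S p, false)) = T 0 by [].
have init : preach (@running P) (conf (special_state 3) 0 (T 0))
    (conf (zigzag_state true false 0 1) 1 (T 0)).
  have := reach_step (@tape_bit P) (@step P) (@at_limit P)
    (@running_special 3 0 (T 0) isT isT).
  by rewrite step_special //= upd_same.
rewrite T0E; apply: reach_trans init _.
have := @zigzag_init true (@running P) false (T 0)
  (fun k j h => @running_zigzag true false k j h (T 0)).
have t0 : (target true 0 == 0) = false by have := lt_target true 0; lia.
rewrite /= (_ : upd _ _ _ = T 0); last first.
  by apply/funext => p; rewrite /upd /T; case: eqVneq => [->|//]; rewrite t0.
move=> r; apply: reach_trans r _.
apply: (@reach_zigzag true y T).
- by [].
- by move=> i p pi; rewrite /T (ltn_eqF pi) pi.
- move=> i /=.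
  have lt := lt_target true i.+1; rewrite -[S (target true i.+1)]/(y i.+1).
  have yE : S (target true i.+1) = y i.+1 by [].
  set t := target _ _ in lt yE *.
  have ti : (t == i) = false by lia.
  have ti1 : (t == i.+1) = false by lia.
  have i1i : (i.+1 == i) = false by lia.
  have it : (i == t) = false by lia.
  have i1t : (i.+1 == t) = false by lia.
  split.
    rewrite /upd /T /= ti ti1 ?i1i ?i1t eqxx /= yE; congr (_, (_, _, _)).
    by have [-> ->] : (t < i) = false /\ (t < i.+1) = false by split; lia.
  move=> p pt; rewrite /upd (negbTE pt) it i1t.
  have [->|pi1] := eqVneq p i.+1.
    by rewrite i1i /T /= ltnn ltnNge leqnSn eqxx.
  have [pi|pi] := eqVneq p i.
    by rewrite /T /= -pi ltnSn; congr (_, _, _); lia.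
  rewrite /T /= (negbTE pi) (negbTE pi1); congr (_, _, _ && _); lia.
Qed.

(** Free offsets hold 0, except that position 0 holds the constant flag 1. *)
Definition sbit (t : nat -> G) (p : nat) : bool :=
  if track_at (p %% M) is Some d then t (p %/ M) d else p == 0.

Definition raw_tape (t : nat -> G) (p : nat) : triple := (p == 0, sbit t p, false).

Definition enc (c : track_config) : config P :=
  conf (sim_start (tstate c)) (M * tpos c) (raw_tape (ttape c)).

Lemma sbit_target t i : sbit t (target true i) = t i dout.
Proof. by rewrite /sbit target_mod target_div /base track_at_offset. Qed.

(** * Simulation of a single step *)

Section SimStep.
Variable c : track_config.
Hypothesis run_c : trunning c.
Local Notation h := (tpos c).
Local Notation c' := (tstep c).
Let q' : Q := (delta (tstate c) (ttape c h)).1.1.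
Let b' : G := (delta (tstate c) (ttape c h)).1.2.
Let d' : bool := (delta (tstate c) (ttape c h)).2.

Let tstepE : c' = TConfig q' (tmove d' h) (upd (ttape c) h b').
Proof. by rewrite /tstep /q' /b' /d'; case: delta => [[q b] d]. Qed.

Definition sim_state_at (m : nat) : raw_state :=
  if m <= M then
    sim_state (tstate c) [ffun d => (offset d < m) && ttape c h d] false m
  else sim_state q' b' d' m.

Definition sim_head (m : nat) : nat :=
  if m <= M then M * h + m
  else if m <= 2 * M then M * h + (2 * M - m)
  else if d' then M * h + (m - 2 * M) else M * h - (m - 2 * M).

(** After [m] steps exactly the offsets above [2 * M - m] of the scanned block have been
    rewritten. *)
Definition sim_tape (m p : nat) : triple :=
  if (p %/ M == h) && (2 * M < m + p %% M) then raw_tape (ttape c') p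
  else raw_tape (ttape c) p.

Lemma sim_tape_small m : m <= M.+1 -> sim_tape m = raw_tape (ttape c).
Proof.
move=> mM; apply/funext => p; rewrite /sim_tape.
have pM : p %% M < M by rewrite ltn_mod.
by rewrite (_ : (2 * M < _) = false) ?andbF //; lia.
Qed.

Lemma sbit_step p : sbit (ttape c') p =
  if p %/ M == h then (if track_at (p %% M) is Some d then b' d else p == 0)
  else sbit (ttape c) p.
Proof. by rewrite tstepE /sbit /= /upd; case: track_at => [d|]; case: ifP. Qed.

Lemma sim_tape_large m : 2 * M <= m -> sim_tape m = raw_tape (ttape c').
Proof.
move=> mM; apply/funext => p; rewrite /sim_tape /raw_tape sbit_step.
case: eqVneq => [e|//]; case: ltnP => //= pm.
have p0 : p %% M = 0 by lia.
rewrite /sbit p0; congr (_, _, _); case t0: track_at => [d|//].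
by have := track_at_Some t0.
Qed.

Lemma sim_iter m : m < 3 * M -> m.+1 < 3 * M ->
  step (conf (sim_state_at m) (sim_head m) (sim_tape m)) =
  conf (sim_state_at m.+1) (sim_head m.+1) (sim_tape m.+1).
Proof.
move=> m3 m3'.
have M2 : 1 < M by [].
rewrite {1}/sim_state_at; have [mM|mM] := leqP m M.
  rewrite step_sim ?(ltnW m3) // /sim_trans.
  rewrite !sim_tape_small ?(leqW mM) // /sim_head mM.
  have [lt|/(conj mM)/andP] := ltnP m M; last first.
    rewrite -eqn_leq => /eqP ->; rewrite eqxx.
    rewrite (_ : [ffun d => _] = ttape c h); last first.
      by apply/ffunP => d; rewrite ffunE offset_lt.
    rewrite /sim_state_at ltnn -/q' -/b' -/d' /q' /b' /d'.
    case: delta => [[q b] d]; rewrite upd_same; congr tape_config.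
    by rewrite (_ : M < 2 * M) /=; lia.
  rewrite /sim_state_at lt upd_same; congr tape_config; last by rewrite /= addnS.
  congr sim_state; apply/ffunP => d; rewrite !ffunE /raw_tape /= /sbit.
  rewrite mulnC modnMDl divnMDl // modn_small // divn_small // addn0.
  case: eqP => [<-|ne]; first by rewrite track_at_offset ltnSn.
  by congr (_ && _); lia.
rewrite step_sim ?(ltnW m3) // /sim_trans.
rewrite (_ : (m < M) = false); last lia.
rewrite (_ : (m == M) = false); last lia.
rewrite /sim_state_at (_ : (m.+1 <= M) = false); last lia.
have [lt|ge] := ltnP m (2 * M); last first.
  rewrite m3' upd_same !sim_tape_large ?(leqW ge) //; congr tape_config.
  rewrite /sim_head (_ : (m <= M) = false); last lia.
  rewrite (_ : (m.+1 <= M) = false); last lia.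
  rewrite (_ : (m.+1 <= 2 * M) = false); last lia.
  by case: (leqP m (2 * M)); case: d' => /=; lia.
have hm : sim_head m = M * h + (2 * M - m).
  by rewrite /sim_head (_ : (m <= M) = false) ?(ltnW lt) //; lia.
have j0 : 2 * M - m < M by lia.
have hmod : sim_head m %% M = 2 * M - m.
  by rewrite hm mulnC modnMDl modn_small.
have hdiv : sim_head m %/ M = h.
  by rewrite hm mulnC divnMDl // divn_small // addn0.
congr tape_config.
  rewrite /= hm /sim_head (_ : (m.+1 <= M) = false); last lia.
  by rewrite lt; lia.
apply/funext => p; rewrite /upd; have [->|ne] := eqVneq p (sim_head m).
  rewrite /sim_tape hdiv hmod eqxx /= (_ : (2 * M < _) = false); last lia.
  rewrite (_ : (2 * M < _) = true); last lia.
  rewrite /raw_tape /= sbit_step hdiv hmod eqxx.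
  congr (_, _, _); rewrite /sbit hmod.
  by case: track_at => [d|].
rewrite /sim_tape; case: eqVneq => //= e.
suff -> : (2 * M < m.+1 + p %% M) = (2 * M < m + p %% M) by [].
suff : p %% M != 2 * M - m by lia.
apply: contra_neq ne => pm.
by rewrite (divn_eq p M) e pm hm mulnC.
Qed.

(** Each scratch cell changes at most once during the 3 * [M] steps, so every bit seen is the old or
    the new one. *)
Lemma reach_sim_step :
  preach (fun d => running d /\ forall o,
      tape_bit o d = tape_bit o (enc c) \/ tape_bit o d = tape_bit o (enc c'))
    (enc c) (enc c').
Proof.
have M2 : 1 < M by [].
pose F m := if m < 3 * M then conf (sim_state_at m) (sim_head m) (sim_tape m) else enc c'.
have F0 : F 0 = enc c.
  rewrite /F /sim_state_at /sim_head sim_tape_small //= addn0 /enc /sim_start.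
  case: eqP => // _; congr tape_config; congr sim_state.
have F3 : F (3 * M) = enc c' by rewrite /F ltnn.
rewrite -F0 -{2}F3; apply: reach_iter => // m m3.
have Fm : F m = conf (sim_state_at m) (sim_head m) (sim_tape m) by rewrite /F m3.
split.
  rewrite Fm F0; split; first by rewrite /sim_state_at; case: ifP.
  move=> o; rewrite !tape_bit_tape_config /sim_tape.
  by case: ifP; [right|left].
have [m3'|mE] := ltnP m.+1 (3 * M); first by rewrite Fm sim_iter // /F m3'.
rewrite [LHS]/F ltnNge mE /= Fm.
have {mE} mE : m = (3 * M).-1 by lia.
rewrite /sim_state_at (_ : (m <= M) = false); last lia.
rewrite step_sim ?(ltnW m3) // /sim_trans.
rewrite (_ : (m < M) = false); last lia.
rewrite (_ : (m == M) = false); last lia.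
rewrite (_ : (m < 2 * M) = false); last lia.
rewrite (_ : (m.+1 < 3 * M) = false); last lia.
rewrite upd_same sim_tape_large; last lia.
rewrite /enc tstepE /=; congr tape_config.
rewrite /sim_head (_ : (m <= M) = false); last lia.
rewrite (_ : (m <= 2 * M) = false); last lia.
have -> : m - 2 * M = M.-1 by lia.
case: d'; rewrite /tmove /move; first by rewrite mulnS; lia.
(* Truncated subtraction covers [h = 0], where both heads stay at the left end. *)
by rewrite -subn1 mulnBr muln1; lia.
Qed.

End SimStep.

Lemma track_at_0 : track_at 0 = None.
Proof. by case t0: (track_at 0) => [d|//]; have := track_at_Some t0. Qed.

Lemma reach_enc a b : treach trunning a b -> preach (@running P) (enc a) (enc b).
Proof.
pose lenc c := conf (special_state 1) 0 (raw_tape (ttape c)).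
apply: (@simulation _ _ _ _ _ _ _ _ _ _ _ _ _ lenc).
- exact: reach_sim_step.
- move=> c [qc hc]; split=> //.
  (* Position 0 shows 1 on the input and the scratch tape, so the limit state resumes the simulation
     in [qlim]. *)
  have -> : enc c = step (lenc c).
    rewrite step_special //= /sbit mod0n track_at_0 /= upd_same.
    by rewrite /enc qc hc muln0.
  apply: reach_step; split; first exact: running_special.
  move=> o; rewrite step_special //= /sbit mod0n track_at_0 /= upd_same.
  by rewrite !tape_bit_tape_config.
- move=> [[] p].
  + by left; exists (p == 0) => c; rewrite tape_bit_tape_config.
  + case t: (track_at (p %% M)) => [d|].
      by right; exists (d, p %/ M) => c; rewrite tape_bit_tape_config /= /sbit t.
    by left; exists (p == 0) => c; rewrite tape_bit_tape_config /= /sbit t.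
  + by left; exists false => c; rewrite tape_bit_tape_config.
Qed.

Theorem raw_program_computes x c :
    treach trunning (tinit x) c -> tstate c = qhalt -> tpos c = 0 ->
  computes P x (fun i => ttape c i dout).
Proof.
move=> /reach_enc r qc hc.
pose L p : triple := (false, sbit (ttape c) p, ttape c p dout).
have -> : (fun i => ttape c i dout) = output_tape (conf (special_state 2) 0 L) by [].
apply: preach_computes => //.
have r1 := reach_raw_input x.
have r2 : preach (@running P) (conf (special_state 1) 0 (raw_input x)) (enc (tinit x)).
  have := reach_step (@tape_bit P) (@step P) (@at_limit P)
    (@running_special 1 0 (raw_input x) isT isT).
  have x0 : raw_input x 0 = (false, false, false) by rewrite /raw_input mod0n.
  rewrite step_special // x0 /= /enc muln0.
  rewrite (_ : upd _ _ _ = raw_tape (ttape (tinit x))) //.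
  apply/funext => p; rewrite /upd /raw_tape /raw_input /sbit.
  have [->|p0] := eqVneq p 0; first by rewrite mod0n track_at_0.
  case t: track_at => [d|].
    by rewrite ffunE (track_at_Some t) (inj_eq offset_inj).
  case: eqVneq => // pm; have := track_at_offset din.
  by rewrite -[offset _]/(base false) -pm t.
have r3 : preach (@running P) (enc c) (conf (special_state 1) 0 L).
  rewrite /enc qc hc /sim_start eqxx muln0.
  have -> : L = fun p => (false, sbit (ttape c) p, sbit (ttape c) (target true p)).
    by apply/funext => p; rewrite sbit_target.
  exact: reach_gather.
have r4 : preach (@running P) (conf (special_state 1) 0 L) (conf (special_state 2) 0 L).
  have := reach_step (@tape_bit P) (@step P) (@at_limit P)
    (@running_special 1 0 L isT isT).
  by rewrite step_special //= /sbit mod0n track_at_0 /= upd_same.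
exact: reach_trans r1 (reach_trans r2 (reach_trans r (reach_trans r3 r4))).
Qed.

End TrackMachine.

(** * Calling programs from a flow chart *)

Section FlowChart.
(* In phase ph the machine calls [prog ph], on the current real if [src ph] and on
   the original input otherwise.  From bit 0 of the result, [next] gives the
   following phase and whether the result becomes the current real; None stops
   with this result.  Phase phinf is entered after infinitely many calls. *)
Variables (Ph : finType) (prog : Ph -> program) (src : Ph -> bool).
Variables (next : Ph -> bool -> option (Ph * bool)) (ph0 phinf : Ph).

(* Tracks: input, scratch and output tape of the called program, the original
   input, the current real, the load mark, the run mark, and one track per phase.
   The marks and the phase are only written at cell 0, where exactly one mark is
   set.  While a call is being loaded or is running the marks are constant, so
   that a limit with both marks set is a limit of infinitely many calls. *)
Definition track : finType := ('I_7 + Ph)%type.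
Definition data_track (k : nat) (k7 : k < 7) : track := inl (Ordinal k7).
Local Notation tin := (@data_track 0 isT).
Local Notation tscr := (@data_track 1 isT).
Local Notation tout := (@data_track 2 isT).
Local Notation torig := (@data_track 3 isT).
Local Notation tcur := (@data_track 4 isT).
Local Notation tload := (@data_track 5 isT).
Local Notation trunm := (@data_track 6 isT).
Local Notation G := {ffun track -> bool}.

Definition cell (a b o x c l r : bool) (f : Ph -> bool) : G :=
  [ffun d : track => match d with
     | inl k => nth false [:: a; b; o; x; c; l; r] k
     | inr ph => f ph
     end].

Definition fstate : finType :=
  ('I_3 + (Ph * 'I_3) + {ph : Ph & states (prog ph)})%type.
Definition fsp (k : nat) (k3 : k < 3) : fstate := inl (inl (Ordinal k3)).
Local Notation fstart := (@fsp 0 isT).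
Local Notation flim := (@fsp 1 isT).
Local Notation fhalt := (@fsp 2 isT).
Definition fpass (ph : Ph) (k : 'I_3) : fstate := inl (inr (ph, k)).
Definition frun (ph : Ph) (q : states (prog ph)) : fstate :=
  inr (Tagged (fun ph => states (prog ph)) q).

(* k = 0 for the initial load, 1 to keep the current real, and 2 to replace it by
   the output of the last call. *)
Definition load (k : nat) (ph : Ph) (first : bool) (s : G) : G :=
  let x := if k is 0 then s tin else s torig in
  let c := match k with 0 => s tin | 1 => s tcur | _ => s tout end in
  cell (if src ph then c else x) false false x c first false
    (fun ph' => first && (ph' == ph)).

Definition load_keep : 'I_3 := @Ordinal 3 1 isT.
Definition load_out : 'I_3 := @Ordinal 3 2 isT.
Definition load_init : 'I_3 := @Ordinal 3 0 isT.

Definition start_load (k : 'I_3) (ph : Ph) (s : G) : fstate * G * bool :=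
  (fpass ph k, load k ph true s, true).

Definition phase_of (s : G) : Ph := odflt ph0 [pick ph | s (inr ph)].

(** At a limit, the load mark alone means that loading is complete, both marks mean infinitely many
    calls, and the run mark alone means a limit of the called program. After a call the head walks
    left until the run mark identifies cell 0. *)
Definition ftrans (q : fstate) (s : G) : fstate * G * bool :=
  match q with
  | inl (inl k) =>
    match nat_of_ord k with
    | 0 => start_load load_init ph0 s
    | 1 =>
      let ph := phase_of s in
      if s tload then
        if s trunm then start_load load_keep phinf s
        else (frun (start_state (prog ph)),
              cell (s tin) (s tscr) (s tout) (s torig) (s tcur) false true
                (fun ph => s (inr ph)), false)
      else (frun (limit_state (prog ph)), s, false)
    | _ => (q, s, false)
    end
  | inl (inr (ph, k)) => (q, load k ph false s, true)
  | inr (existT ph p) =>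
    if p == halt_state (prog ph) then
      if s trunm then
        match next ph (s tout) with
        | Some (ph', u) => start_load (if u then load_out else load_keep) ph' s
        | None => (fhalt, s, false)
        end
      else (q, s, false)
    else
      let: (p', (a, b, o), d) := transition p (s tin, s tscr, s tout) in
      (frun p',
       cell a b o (s torig) (s tcur) (s tload) (s trunm) (fun ph => s (inr ph)),
       if d is MoveRight then true else false)
  end.

Local Notation tconf := (track_config track fstate).
Local Notation fbit := (@tbit track fstate).
Local Notation fstep := (tstep ftrans).
Local Notation flimit := (tat_limit (D := track) flim).
Local Notation frunning := (trunning (D := track) fhalt).
Local Notation freach := (reach fbit fstep flimit).
Local Notation fpassage := (passage fbit fstep flimit).

Definition arg (ph : Ph) (x c : real) : real := if src ph then c else x.

Definition loaded (ph : Ph) (x c : real) : tconf :=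
  TConfig flim 0 (fun i => cell (arg ph x c i) false false (x i) (c i) (i == 0)
    false (fun ph' => (i == 0) && (ph' == ph))).

Definition ok (x : real) (d : tconf) : Prop :=
  frunning d /\ forall i, ttape d i torig = x i.

(** The pass rewrites each cell once, moving right for omega steps, so every cell converges. *)
Lemma reach_pass (R : tconf -> Prop) ph k T :
    (forall n, R (TConfig (fpass ph k) n.+1
      (fun i => if i <= n then load k ph (i == 0) (T i) else T i))) ->
  freach R (TConfig (fpass ph k) 1 (upd T 0 (load k ph true (T 0))))
    (TConfig flim 0 (fun i => load k ph (i == 0) (T i))).
Proof.
move=> RF.
pose F n := TConfig (fpass ph k) n.+1
  (fun i => if i <= n then load k ph (i == 0) (T i) else T i).
have -> : TConfig (fpass ph k) 1 (upd T 0 (load k ph true (T 0))) = F 0.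
  by congr TConfig; apply/funext => i; rewrite /upd leqn0; case: eqP => [->|].
pose Qd n d := R d /\ forall t i, i <= n -> ttape d i t = load k ph (i == 0) (T i) t.
apply: (@reach_omega _ _ _ _ _ R Qd F).
- move=> n; have -> : F n.+1 = fstep (F n).
    rewrite /tstep /F /= ltnn; congr TConfig; apply/funext => i; rewrite /upd.
    by rewrite leq_eqVlt ltnS; case: eqVneq => [->|].
  by apply: reach_step; split=> [|t i ni]; [exact: RF|rewrite /F /= ni].
- by move=> n d [].
- by [].
- move=> [t i]; exists i => n d ni [_ dE]; by rewrite /tbit /= dE.
Qed.

Lemma load_loaded k ph x c (T : nat -> G) :
    (forall i, (if k is 0 then T i tin else T i torig) = x i) ->
    (forall i, match k with 0 => T i tin | 1 => T i tcur | _ => T i tout end = c i) ->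
  TConfig flim 0 (fun i => load k ph (i == 0) (T i)) = loaded ph x c.
Proof.
move=> xE cE; congr TConfig; apply/funext => i.
by rewrite /load xE cE /arg; case: (src ph).
Qed.

Section Run.
Variables (ph : Ph) (x c : real).

Definition run_tape (C : config (prog ph)) (i : nat) : G :=
  cell (input_tape C i) (scratch_tape C i) (output_tape C i) (x i) (c i)
    false (i == 0) (fun ph' => (i == 0) && (ph' == ph)).

Definition run_enc (C : config (prog ph)) : tconf :=
  TConfig (frun (state C)) (head_pos C) (run_tape C).

Lemma run_ok C : ok x (run_enc C).
Proof. by split=> // i; rewrite /= ffunE. Qed.

Lemma loaded_ok : ok x (loaded ph x c).
Proof. by split=> // i; rewrite /= ffunE. Qed.

Lemma phase_of_cell a b o x' c' l r :
  phase_of (cell a b o x' c' l r (fun ph' => ph' == ph)) = ph.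
Proof.
rewrite /phase_of; case: pickP => [ph'|/(_ ph)]; rewrite ffunE /= ?eqxx //.
by move/eqP.
Qed.

Lemma step_loaded : fstep (loaded ph x c) = run_enc (init_config (prog ph) (arg ph x c)).
Proof.
rewrite /tstep /= phase_of_cell.
rewrite !ffunE /=; congr TConfig; apply/funext => i.
rewrite /upd /run_tape; case: eqVneq => [->|//].
by apply/ffunP => -[k|ph']; rewrite !ffunE.
Qed.

Lemma step_run C : state C <> halt_state (prog ph) -> fstep (run_enc C) = run_enc (step C).
Proof.
move=> /eqP/negbTE nh; rewrite /tstep /= nh !ffunE /= /run_enc /run_tape /step.
case: transition => [[q [[a b] o]] d] /=.
congr TConfig; first by case: d.
apply/funext => i; rewrite /upd /write; case: eqVneq => [->|//].
by apply/ffunP => -[k|ph']; rewrite !ffunE.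
Qed.

(** Steps correspond one to one. The tracks not belonging to the callee are constant, so at its
    limits cell 0 still shows the run mark alone and the phase. *)
Lemma reach_run C C' :
  preach (@running (prog ph)) C C' -> freach (ok x) (run_enc C) (run_enc C').
Proof.
pose lenc C := TConfig flim 0 (run_tape C).
apply: (@simulation _ _ _ _ _ _ _ _ _ _ _ _ _ lenc) => [C0 nh|C0 [qC hC]|[d i]].
- rewrite -step_run //; apply: reach_step; split; first exact: run_ok.
  by move=> o; left.
- have e : run_enc C0 = fstep (lenc C0).
    rewrite /tstep /= phase_of_cell.
    rewrite !ffunE /= /run_enc qC hC; congr TConfig.
    by rewrite upd_same.
  split=> //; rewrite e; apply: reach_step; split.
    by split=> // i; rewrite /= ffunE.
  by move=> o; rewrite -e.
- rewrite /tbit /=; case: d => [[[|[|[|[|[|[|[|//]]]]]]] k]|ph'].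
  + by right; exists (InputTape, i) => C0; rewrite ffunE.
  + by right; exists (ScratchTape, i) => C0; rewrite ffunE.
  + by right; exists (OutputTape, i) => C0; rewrite ffunE.
  + by left; exists (x i) => C0; rewrite ffunE.
  + by left; exists (c i) => C0; rewrite ffunE.
  + by left; exists false => C0; rewrite ffunE.
  + by left; exists (i == 0) => C0; rewrite ffunE.
  + by left; exists ((i == 0) && (ph' == ph)) => C0; rewrite ffunE.
Qed.

Lemma reach_home C : state C = halt_state (prog ph) ->
  freach (ok x) (run_enc C) (fstep (TConfig (frun (state C)) 0 (run_tape C))).
Proof.
move=> hC; rewrite /run_enc; elim: (head_pos C) => [|h IH].
  by apply: reach_step; split=> // i; rewrite /= ffunE.
apply: reach_trans IH.
have -> : TConfig (frun (state C)) h (run_tape C) =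
    fstep (TConfig (frun (state C)) h.+1 (run_tape C)).
  by rewrite /tstep /= hC eqxx !ffunE /= upd_same.
by apply: reach_step; split=> // i; rewrite /= ffunE.
Qed.

Lemma reach_call z : computes (prog ph) (arg ph x c) z ->
  exists C, [/\ state C = halt_state (prog ph), output_tape C = z
    & freach (ok x) (run_enc (init_config (prog ph) (arg ph x c)))
        (fstep (TConfig (frun (state C)) 0 (run_tape C)))].
Proof.
move=> /computes_preach[C [r hC oC]]; exists C; split=> //.
exact: reach_trans (reach_run r) (reach_home hC).
Qed.

End Run.

(* The visit to a configuration with the run mark is recorded because it forces
   that mark to be set in the limit of infinitely many hops. *)
Definition hop (x : real) (a b : Ph * real) : Prop :=
  exists V, [/\ fpassage V (loaded a.1 x a.2) (loaded b.1 x b.2),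
    forall d, V d -> ok x d & exists2 d, V d & ttape d 0 trunm].

Lemma hop_trans x b a c : hop x a b -> hop x b c -> hop x a c.
Proof.
move=> [V1 [p1 o1 [d d1 dr]]] [V2 [p2 o2 _]]; exists (fun d => V1 d \/ V2 d).
split; [exact: passage_trans p2|by move=> e [/o1|/o2]|by exists d; auto].
Qed.

Lemma hop_next x ph c z ph' u : computes (prog ph) (arg ph x c) z ->
  next ph (z 0) = Some (ph', u) -> hop x (ph, c) (ph', if u then z else c).
Proof.
move=> /reach_call[C [hC oC r]] nx.
have [V pV VR] : freach (ok x) (run_enc x c (init_config (prog ph) (arg ph x c)))
    (loaded ph' x (if u then z else c)).
  apply: reach_trans r _; pose k := if u then load_out else load_keep.
  have -> : fstep (TConfig (frun (state C)) 0 (run_tape x c C)) =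
      TConfig (fpass ph' k) 1 (upd (run_tape x c C) 0 (load k ph' true (run_tape x c C 0))).
    by rewrite /tstep /= hC eqxx !ffunE /= oC nx.
  rewrite -(@load_loaded k _ _ _ (run_tape x c C)); last first.
  - by move=> i; rewrite /k -oC; case: (u); rewrite /= ffunE.
  - by move=> i; rewrite /k; case: (u); rewrite /= ffunE.
  apply: reach_pass => n; split=> // i; rewrite /= /k.
  by case: ifP => _; rewrite !ffunE //=; case: (u); rewrite /= ?ffunE.
have p0 : fpassage (fun d => d = loaded ph x c) (loaded ph x c)
    (run_enc x c (init_config (prog ph) (arg ph x c))).
  by rewrite -step_loaded; exact: passage_step.
exists (fun d => d = loaded ph x c \/ V d); split; first exact: passage_trans pV.
- by move=> d [->|/VR]; [exact: loaded_ok|].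
- exists (run_enc x c (init_config (prog ph) (arg ph x c))).
    by right; exact: passage_start pV.
  by rewrite /= ffunE.
Qed.

Definition yields (x : real) (a : Ph * real) (y : real) : Prop :=
  exists d, [/\ freach frunning (loaded a.1 x a.2) d, tstate d = fhalt,
    tpos d = 0 & (fun i => ttape d i tout) = y].

Lemma yields_hop x a b y : hop x a b -> yields x b y -> yields x a y.
Proof.
move=> [V [pV VR _]] [d [r hd h0 yd]]; exists d; split=> //.
by apply: reach_trans r; exists V => // e /VR[].
Qed.

Lemma yields_stop x ph c z : computes (prog ph) (arg ph x c) z ->
  next ph (z 0) = None -> yields x (ph, c) z.
Proof.
move=> /reach_call[C [hC oC r]] nx.
exists (fstep (TConfig (frun (state C)) 0 (run_tape x c C))).
have e : fstep (TConfig (frun (state C)) 0 (run_tape x c C)) =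
    TConfig fhalt 0 (run_tape x c C).
  by rewrite /tstep /= hC eqxx !ffunE /= oC nx upd_same.
split; rewrite ?e //; last by apply/funext => i; rewrite /= ffunE -oC.
apply: (@reach_trans _ _ _ _ _ _ _ (fstep (loaded ph x c))).
  by apply: reach_step; case: (loaded_ok ph x c).
by rewrite step_loaded -e; apply: reach_weaken r => d [].
Qed.

(** Each hop shows the load mark and the run mark once, so both are 1 at the limit, while the
    original input is constant. Nothing is known about the limit of the current reals, whence the
    quantification over [c]. *)
Lemma yields_inf x (s : nat -> Ph * real) y :
    (forall n, hop x (s n) (s n.+1)) -> (forall c, yields x (phinf, c) y) ->
  yields x (s 0) y.
Proof.
move=> /choice[V pV] inf.
pose F n := loaded (s n).1 x (s n).2.
pose cof (o : track * nat) := forall n, exists k,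
  [/\ n <= k & exists2 d, V k d & fbit o d].
(* The limit tape is defined as the limsup itself, since the cells need not converge. *)
pose T (i : nat) : G := [ffun t => `[< cof (t, i) >]].
have toL : freach frunning (F 0) (TConfig flim 0 T).
  exists (fun d => exists n, V n d); last first.
    by move=> d [n Vd]; case: (pV n) => _ /(_ d Vd)[].
  apply: passage_omega => // [n|[t i]]; first by case: (pV n).
  by rewrite /tbit /= ffunE asboolE.
have TL : T 0 tload.
  rewrite ffunE; apply/asboolP => n; exists n; split=> //; exists (F n).
    by have [p _ _] := pV n; exact: passage_start p.
  by rewrite /tbit /= ffunE.
have TR : T 0 trunm.
  by rewrite ffunE; apply/asboolP => n; exists n; split=> //; case: (pV n).
have TX i : T i torig = x i.
  rewrite ffunE; apply/asboolP/idP => [/(_ 0)[k [_ [d Vd]]]|xi n].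
    by case: (pV k) => _ /(_ d Vd)[_ dx] _; rewrite /tbit /= dx.
  exists n; split=> //; exists (F n); last by rewrite /tbit /= ffunE.
  by have [p _ _] := pV n; exact: passage_start p.
pose c i := T i tcur.
have [d [r hd h0 yd]] := inf c; exists d; split=> //.
apply: reach_trans toL _; apply: reach_trans (reach_step _ _ _ _) _ => //.
apply: reach_trans r.
have -> : fstep (TConfig flim 0 T) =
    TConfig (fpass phinf load_keep) 1 (upd T 0 (load load_keep phinf true (T 0))).
  by rewrite /tstep /ftrans [nat_of_ord _]/= [ttape _ _]/= TL TR.
rewrite -(@load_loaded load_keep phinf x c T) //.
exact: reach_pass.
Qed.

Definition flow_program : program :=
  raw_program fstart flim fhalt ftrans tin tout.

Theorem flow_computes x y : yields x (ph0, x) y -> computes flow_program x y.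
Proof.
move=> [d [r hd h0 <-]]; apply: raw_program_computes => //.
apply: reach_trans r.
apply: reach_trans (reach_step _ _ _ _) _; first by [].
rewrite -(@load_loaded load_init ph0 x x (ttape (tinit fstart tin x))).
- exact: reach_pass.
- by move=> i; rewrite /= ffunE eqxx.
- by move=> i; rewrite /= ffunE eqxx.
Qed.

End FlowChart.

(** * Chains and the permutation *)

Local Open Scope classical_set_scope.

Section Chains.
Variables (f g : real -> real).
Hypotheses (f_inj : injective f) (g_inj : injective g).

(** A terminating backward search, generated forwards from its end point: induction then follows the
    length of the search. *)
Inductive chain_from (S : real -> Prop) : real -> Prop :=
| chain_start x of S x : chain_from S x
| chain_next x of chain_from S x : chain_from S (g (f x)).

Definition B_rooted : real -> Prop :=
  chain_from (fun x => exists2 y, x = g y & ~ range f y).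
Definition A_rooted : real -> Prop := chain_from (fun x => ~ range g x).

(** By injectivity the predecessor is unique, and [g (f x)] cannot be a starting point because [f x]
    is in the range of [f]. *)
Lemma B_rooted_next x : B_rooted (g (f x)) <-> B_rooted x.
Proof.
split=> [bx|]; last exact: chain_next.
move e: (g (f x)) bx => z bz; case: bz e => [_ [y -> ny] /g_inj fx|]; last first.
  by move=> x' bx' /g_inj/f_inj ->.
by case: ny; exists x.
Qed.

Lemma B_rooted_image y : ~ range f y -> B_rooted (g y).
Proof. by move=> ny; apply: chain_start; exists y. Qed.

(** Iterating this yields the infinite backward chain along which the search never stops. *)
Lemma unrooted_pred x : ~ A_rooted x -> ~ B_rooted x ->
  exists x', [/\ x = g (f x'), ~ A_rooted x' & ~ B_rooted x'].
Proof.
move=> na nb; have [y _ yx] : range g x.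
  by apply: contrapT => nr; apply: na; exact: chain_start.
have [x' _ fx'] : range f y.
  by apply: contrapT => nr; apply: nb; rewrite -yx; exact: B_rooted_image.
exists x'; split; first by rewrite fx'.
- by move=> ax'; apply: na; rewrite -yx -fx'; exact: chain_next.
- by move=> bx'; apply: nb; rewrite -yx -fx'; exact: chain_next.
Qed.

Variables (pf_inv pg_inv pf_ran pg_ran pA pB : program).
Hypothesis pf_invP : forall x, computes pf_inv (f x) x.
Hypothesis pg_invP : forall y, computes pg_inv (g y) y.
Hypothesis pf_ranP : forall y, computes pf_ran y (real_of_nat (y \in range f)).
Hypothesis pg_ranP : forall x, computes pg_ran x (real_of_nat (x \in range g)).

Local Notation ph k := (@Ordinal 6 k isT).

(* Phases 0 and 1 test membership in range g and apply g^-1; phases 2 and 3 do the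
   same for f; phases 4 and 5 apply the final map to the original input. *)
Definition chain_prog (i : 'I_6) : program :=
  nth pA [:: pg_ran; pg_inv; pf_ran; pf_inv; pA; pB] i.
Definition chain_src (i : 'I_6) : bool := i < 4.
Definition chain_dispatch (i : 'I_6) (b : bool) : option ('I_6 * bool) :=
  match nat_of_ord i with
  | 0 => Some (if b then ph 1 else ph 4, false)
  | 1 => Some (ph 2, true)
  | 2 => Some (if b then ph 3 else ph 5, false)
  | 3 => Some (ph 0, true)
  | _ => None
  end.
(** Phase 4 serves both a chain that stops outside [range g] and one that never stops. *)
Definition chain_program (start : 'I_6) : program :=
  flow_program chain_prog chain_src chain_dispatch start (ph 4).

Variable start : 'I_6.
Local Notation hop := (@hop 'I_6 chain_prog chain_src chain_dispatch start (ph 4)).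
Local Notation yields := (@yields 'I_6 chain_prog chain_src chain_dispatch start (ph 4)).

Lemma real_of_bool (b : bool) : real_of_nat b 0 = b.
Proof. by case: b. Qed.

Lemma hop_ran_g x0 x : hop x0 (ph 0, x) (if x \in range g then ph 1 else ph 4, x).
Proof.
by apply: (@hop_next 'I_6 chain_prog chain_src chain_dispatch start (ph 4)
  _ (ph 0) x (real_of_nat (x \in range g)) _ false);
  [exact: pg_ranP|rewrite real_of_bool].
Qed.

Lemma hop_inv_g x0 y : hop x0 (ph 1, g y) (ph 2, y).
Proof.
by apply: (@hop_next 'I_6 chain_prog chain_src chain_dispatch start (ph 4)
  _ (ph 1) (g y) y _ true) => //; exact: pg_invP.
Qed.

Lemma hop_ran_f x0 y : hop x0 (ph 2, y) (if y \in range f then ph 3 else ph 5, y).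
Proof.
by apply: (@hop_next 'I_6 chain_prog chain_src chain_dispatch start (ph 4)
  _ (ph 2) y (real_of_nat (y \in range f)) _ false);
  [exact: pf_ranP|rewrite real_of_bool].
Qed.

Lemma hop_inv_f x0 x : hop x0 (ph 3, f x) (ph 0, x).
Proof.
by apply: (@hop_next 'I_6 chain_prog chain_src chain_dispatch start (ph 4)
  _ (ph 3) (f x) x _ true) => //; exact: pf_invP.
Qed.

Lemma hop_f x0 x : hop x0 (ph 2, f x) (ph 0, x).
Proof.
apply: hop_trans (hop_inv_f x0 x); have := hop_ran_f x0 (f x).
by rewrite (_ : (f x \in range f) = true) //; apply/mem_set; exists x.
Qed.

Lemma hop_g x0 y : hop x0 (ph 0, g y) (ph 2, y).
Proof.
apply: hop_trans (hop_inv_g x0 y); have := hop_ran_g x0 (g y).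
by rewrite (_ : (g y \in range g) = true) //; apply/mem_set; exists y.
Qed.

Lemma hop_gf x0 x : hop x0 (ph 0, g (f x)) (ph 0, x).
Proof. exact: hop_trans (hop_g x0 (f x)) (hop_f x0 x). Qed.

Lemma yields_A x0 c y : computes pA x0 y -> yields x0 (ph 4, c) y.
Proof. by move=> cA; apply: yields_stop => //. Qed.

Lemma yields_fresh x0 z y : ~ range f z -> computes pB x0 y -> yields x0 (ph 2, z) y.
Proof.
move=> nz cB; have h := hop_ran_f x0 z; rewrite memNset // in h.
by apply: yields_hop h _; apply: yields_stop.
Qed.

Lemma yields_B_rooted x0 x y :
  B_rooted x -> computes pB x0 y -> yields x0 (ph 0, x) y.
Proof.
move=> bx cB; elim: bx => {x} [_ [z -> nz]|x _ IH].
  exact: yields_hop (hop_g x0 z) (yields_fresh nz cB).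
exact: yields_hop (hop_gf x0 x) IH.
Qed.

Lemma yields_not_B_rooted x0 x y :
  ~ B_rooted x -> computes pA x0 y -> yields x0 (ph 0, x) y.
Proof.
move=> nb cA; have [ax|na] := pselect (A_rooted x).
  elim: ax {nb} => {x} [x nx|x _ IH]; last exact: yields_hop (hop_gf x0 x) IH.
  by have h := hop_ran_g x0 x; rewrite memNset // in h; apply: yields_hop h _; exact: yields_A.
(* The default [z] only makes [next] total; all iterates of [x] fall in the first case. *)
pose next z := if pselect (exists x', [/\ z = g (f x'), ~ A_rooted x' & ~ B_rooted x'])
  is left e then sval (cid e) else z.
pose s n := (ph 0, iter n next x).
apply: (@yields_inf 'I_6 chain_prog chain_src chain_dispatch start (ph 4) _ s); last first.
  by move=> c; exact: yields_A.
move=> n.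
rewrite /s; set z := iter n next x.
suff [nz e] : (~ A_rooted z /\ ~ B_rooted z) /\ z = g (f (next z)).
  by rewrite iterS -/z {1}e; exact: hop_gf.
have nextP w : ~ A_rooted w -> ~ B_rooted w ->
    [/\ w = g (f (next w)), ~ A_rooted (next w) & ~ B_rooted (next w)].
  move=> naw nbw; rewrite /next; case: pselect => [e|[]]; first exact: (svalP (cid e)).
  exact: unrooted_pred.
have [naz nbz] : ~ A_rooted z /\ ~ B_rooted z.
  by rewrite /z; elim: (n) => //= m [/nextP h /h[]].
by split=> //; have [] := nextP z naz nbz.
Qed.

End Chains.

Theorem theorem47 (A B : set real) (f g : real -> real)
  (f_inj : injective f) (g_inj : injective g)
  (f_red : forall x, A x <-> B (f x))
  (g_red : forall x, B x <-> A (g x))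
  (f_comp : it_computable f) (g_comp : it_computable g)
  (f_inv : it_computable_inverse f) (g_inv : it_computable_inverse g)
  (f_ran : it_decidable (range f)) (g_ran : it_decidable (range g)) :
  exists pi : real -> real,
    [/\ bijective pi, it_computable pi, it_computable_inverse pi
      & pi @` A = B].
Proof.
have /choice[pi piP] : forall x, exists y,
    B_rooted f g x /\ x = g y \/ ~ B_rooted f g x /\ y = f x.
  move=> x; have [bx|nbx] := pselect (B_rooted f g x); last by exists (f x); right.
  suff [y xy] : exists y, x = g y by exists y; left.
  by case: bx => [_ [y -> _]|x' _]; eexists.
(* The test is made at [g y], since the backward chain of [g y] passes first through [y]. *)
have /choice[pi' pi'P] : forall y, exists x,
    B_rooted f g (g y) /\ x = g y \/ ~ B_rooted f g (g y) /\ y = f x.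
  move=> y; have [by_|nby] := pselect (B_rooted f g (g y)); first by exists (g y); left.
  have [x _ xy] : range f y.
    by apply: contrapT => nr; apply: nby; exact: B_rooted_image.
  by exists x; right.
have rooted_gf := B_rooted_next f_inj g_inj.
have pi'K : cancel pi' pi.
  move=> y; case: (pi'P y) => -[]; case: (piP (pi' y)) => -[bx xy] bgy e.
  - by apply: g_inj; rewrite -xy.
  - by case: bx; rewrite e.
  - by case: bgy; rewrite e; apply/rooted_gf.
  - by rewrite xy.
have piK : cancel pi pi'.
  move=> x; case: (piP x) => -[bx xy]; case: (pi'P (pi x)) => -[bgy e].
  - by rewrite e.
  - by case: bgy; rewrite -xy.
  - by case: bx; apply/rooted_gf; rewrite -xy.
  - by apply: f_inj; rewrite -e.
have AB x : A x <-> B (pi x).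
  case: (piP x) => -[bx xy]; last by rewrite xy.
  by rewrite {1}xy; apply: iff_sym.
have [[pf pfP] [pg pgP]] := (f_comp, g_comp).
have [[pfi pfiP] [pgi pgiP]] := (f_inv, g_inv).
have [[pdf pdfP] [pdg pdgP]] := (f_ran, g_ran).
have {}pdfP y := (pdfP y _).2 erefl; have {}pdgP y := (pdgP y _).2 erefl.
have {}pfiP x : computes pfi (f x) x by apply/pfiP.
have {}pgiP y : computes pgi (g y) y by apply/pgiP.
exists pi; split.
- by exists pi'.
- apply: (@computes_it_computable
    (chain_program pfi pgi pdf pdg pf pgi (@Ordinal 6 0 isT))) => x.
  apply: flow_computes; case: (piP x) => -[bx xy].
    by apply: yields_B_rooted => //; rewrite {1}xy.
  by apply: yields_not_B_rooted => //; apply/pfP.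
(* The same search is entered at phase 2, because [y] lies on the [B] side; its final maps are the
   inverse of [f] and [g]. *)
- exists (chain_program pfi pgi pdf pdg pfi pg (@Ordinal 6 2 isT)) => y x.
  suff c : computes (chain_program pfi pgi pdf pdg pfi pg (@Ordinal 6 2 isT)) y (pi' y).
    split=> [/(computes_uniq c) <-|yx]; first by rewrite pi'K.
    by move: c; rewrite {2}yx piK.
  apply: flow_computes.
  have [[x' _ fx']|ny] := pselect (range f y); last first.
    case: (pi'P y) => -[bgy e]; last by case: ny; exists (pi' y).
    by apply: yields_fresh => //; apply/pgP.
  apply: yields_hop; first by rewrite -fx'; exact: hop_f.
  case: (pi'P y) => -[bgy e].
    apply: yields_B_rooted => //; last exact/pgP.
    by apply/rooted_gf; rewrite fx'.
  apply: yields_not_B_rooted => //; last by rewrite {1}e.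
  by move=> /rooted_gf; rewrite fx'.
- apply/seteqP; split=> [_ [x Ax <-]|y By]; first exact/AB.
  by exists (pi' y); [apply/AB; rewrite pi'K|rewrite pi'K].
Qed.
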